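(* For every constant integer $k\ge 1$, the $k$-hierarchical $3\frac12$-coloring problem on bounded-degree trees has (deterministic) worst-case complexity $\Theta(\log^* n)$.
   Context: Model. In the deterministic LOCAL model, the $n$-node input graph is a communication network; nodes have unique identifiers from $\{1,\dots,n^{O(1)}\}$ and know $n$; computation proceeds in synchronous rounds, in each of which each node may send an arbitrarily large message to each neighbor and perform arbitrary local computation. The worst-case complexity of an algorithm is the maximum, over all $n$-node trees of maximum degree at most a constant $\Delta\ge 3$ (and all identifier assignments), of the number of rounds until all nodes have terminated; that of a problem is the best one achieved by an algorithm solving it. $\log^*$ is the iterated logarithm. $k$-hierarchical $3\frac12$-coloring. There are no input labels. Each node of a tree gets a level in $\{1,\dots,k+1\}$: for $i=1,\dots,k$ in this order, let $V_i$ be the set of nodes of degree at most $2$ in the remaining tree; these have level $i$ and are removed; the nodes remaining at the end have level $k+1$. Each node outputs one label of $\{R,G,Y,W,B,E,D\}$ such that: (i) no node of level $1$ is labeled $E$; (ii) all nodes of level $k+1$ are labeled $E$; (iii) a node of level $2\le i\le k$ is labeled $E$ if and only if it is adjacent to a lower-level node labeled $W$, $B$ or $E$; (iv) a node of level $1\le i<k$ labeled $W$ (resp. $B$) has no neighbor of level $i$ labeled $W$ (resp. $B$) or $D$, and nodes of these levels do not output $R,G,Y$; (v) nodes of level $k$ are not labeled $D$, $W$ or $B$, and adjacent nodes of level $k$ do not have the same label among $R,G,Y$ (so level-$k$ nodes not labeled $E$ are properly 3-colored with $R,G,Y$). *)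

(* Defs.v *)
From mathcomp Require Import all_boot.

Set Implicit Arguments.
Unset Strict Implicit.
Unset Printing Implicit Defensive.

(** * Deterministic LOCAL model *)

(* The program of a node.  [init id d] is the state of a node with identifier
   [id] and [d] neighbors before the first round.  In a round, a node in state
   [s] sends [send s i] through its port [i < d], and moves to [recv s ms],
   where [ms] lists the received messages in the order of its ports.
   [output s = Some o] means that the node has terminated with output [o]. *)
Record machine (Out : Type) := Machine {
  state : Type;
  message : Type;
  init : nat -> nat -> state;
  send : state -> nat -> message;
  recv : state -> seq message -> state;
  output : state -> option Out }.

(* Nodes know [n]: on [n]-node networks, [A : algorithm Out] runs [A n]. *)
Definition algorithm (Out : Type) := nat -> machine Out.

(* [ports v] lists the neighbors of [v] in the order of the ports of [v]. *)
Record network := Network {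
  node : finType;
  adj : rel node;
  ident : node -> nat;
  ports : node -> seq node }.

Definition is_tree (V : finType) (e : rel V) : Prop :=
  [/\ symmetric e, irreflexive e, 0 < #|V|, forall u v, connect e u v
    & forall c : seq V, ucycle e c -> size c <= 2].

Definition degree (V : finType) (e : rel V) (v : V) : nat :=
  #|[set u | e v u]|.

(* [n]-node trees of maximum degree at most [Delta], with distinct identifiers
   from {1, ..., n ^ c} and an arbitrary port numbering. *)
Record tree_instance (Delta c n : nat) (G : network) : Prop := TreeInstance {
  card_node : #|node G| = n;
  adj_tree : is_tree (@adj G);
  degree_bounded : forall v, degree (@adj G) v <= Delta;
  ident_inj : injective (@ident G);
  ident_range : forall v : node G, 1 <= ident v <= n ^ c;
  ports_uniq : forall v : node G, uniq (ports v);
  mem_ports : forall u v : node G, (u \in ports v) = adj v u }.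

Section Execution.

Variables (Out : Type) (A : algorithm Out) (G : network).

Let M := A #|node G|.

(* State of [v] after [t] rounds.  A terminated node no longer changes its
   state, so its output is final; its neighbors keep receiving the messages
   determined by that last state. *)
Fixpoint run (t : nat) (v : node G) : state M :=
  if t is t'.+1 then
    let s := run t' v in
    if output s is Some _ then s
    else recv s [seq send (run t' u) (index v (ports u)) | u <- ports v]
  else init M (ident v) (size (ports v)).

Definition output_at (t : nat) (v : node G) : option Out := output (run t v).

Definition all_terminated (t : nat) : Prop := forall v, output_at t v <> None.

Definition rounds (t : nat) : Prop :=
  all_terminated t /\ forall t', all_terminated t' -> t <= t'.

End Execution.

(* A problem is the family of its valid output labelings. *)
Definition problem (Out : Type) :=
  forall V : finType, rel V -> (V -> Out) -> Prop.

Section Complexity.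

Variables (Out : Type) (P : problem Out) (Delta c : nat).

Definition solves (A : algorithm Out) : Prop :=
  forall n G, tree_instance Delta c n G ->
  exists t (out : node G -> Out),
    (forall v, output_at A t v = Some (out v)) /\ P (@adj G) out.

(* The function [T] is the worst-case complexity of [A]; there is no tree with
   0 nodes, so [T 0] is unconstrained. *)
Definition alg_complexity (A : algorithm Out) (T : nat -> nat) : Prop :=
  forall n, 0 < n ->
    (forall G, tree_instance Delta c n G ->
       exists2 t, rounds A G t & t <= T n) /\
    (exists2 G, tree_instance Delta c n G & rounds A G (T n)).

(* As nodes know [n], the best complexity is a pointwise minimum. *)
Definition problem_complexity (T : nat -> nat) : Prop :=
  (exists2 A, solves A & alg_complexity A T) /\
  (forall A T', solves A -> alg_complexity A T' ->
     forall n, 0 < n -> T n <= T' n).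

End Complexity.

(** * Asymptotics *)

(* log* n is the least i such that the i-th iterate of log_2 at n is at most 1.
   Rounding each logarithm up does not change it, as [up_log 2 n <= m] iff
   [n <= 2 ^ m]; the search bound is large enough since log* n <= n. *)
Definition logstar (n : nat) : nat :=
  find (fun i => iter i (up_log 2) n <= 1) (iota 0 n.+1).

Definition bigTheta (f g : nat -> nat) : Prop :=
  exists a b n0 : nat, [/\ 0 < a, 0 < b &
    forall n, n0 <= n -> g n <= a * f n /\ f n <= b * g n].

(** * Hierarchical 3 1/2-coloring *)

Section Levels.

Variables (V : finType) (e : rel V).

Definition low_degree (S : {set V}) : {set V} :=
  [set v in S | #|[set u in S | e v u]| <= 2].

Fixpoint remaining (i : nat) : {set V} :=
  if i is j.+1 then remaining j :\: low_degree (remaining j) else setT.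

(* The set V_i, for i >= 1. *)
Definition layer (i : nat) : {set V} := low_degree (remaining i.-1).

(* The i in {1, ..., k} such that [v \in layer i], or k + 1 if there is none. *)
Definition level (k : nat) (v : V) : nat :=
  (find (fun i => v \in layer i) (iota 1 k)).+1.

End Levels.

(* R, G, Y, W, B, E, D *)
Inductive label := Red | Green | Yellow | White | Black | Exempt | Decline.

Record hierarchical_3half_coloring (k : nat) (V : finType) (e : rel V)
    (out : V -> label) : Prop := Hierarchical3HalfColoring {
  level1_rule : forall v, level e k v = 1 -> out v <> Exempt;
  top_level_rule : forall v, level e k v = k.+1 -> out v = Exempt;
  exempt_rule : forall v, 2 <= level e k v <= k ->
    (out v = Exempt <->
     exists u, [/\ e v u, level e k u < level e k v
                 & [\/ out u = White, out u = Black | out u = Exempt]]);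
  white_rule : forall v, 1 <= level e k v < k -> out v = White ->
    forall u, e v u -> level e k u = level e k v ->
    out u <> White /\ out u <> Decline;
  black_rule : forall v, 1 <= level e k v < k -> out v = Black ->
    forall u, e v u -> level e k u = level e k v ->
    out u <> Black /\ out u <> Decline;
  low_level_labels : forall v, 1 <= level e k v < k ->
    [/\ out v <> Red, out v <> Green & out v <> Yellow];
  level_k_labels : forall v, level e k v = k ->
    [/\ out v <> Decline, out v <> White & out v <> Black];
  level_k_rule : forall u v, e u v -> level e k u = k -> level e k v = k ->
    [\/ out u = Red, out u = Green | out u = Yellow] -> out u <> out v }.

(* Main.v *)
Require Import Defs.
From mathcomp Require Import all_boot zify.
From mathcomp Require Import boolp.

(* Upper bound: when all nodes of level below [k] output D, no node of level at
   most [k] has to output E, and it remains to 3-color the nodes of level [k],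
   which induce a graph of maximum degree 2.

   Lower bound: let [T] be the running time on [n]-node trees.  Take a path of
   blocks, where a block is a root from which hangs a path of length Theta(T) of
   blocks of the next lower type, [k] types in all; far from the ends, the level
   of a node is its type.  A node of level [j < k] labeled W or B would force a
   2-coloring of its long path, which [T] rounds cannot achieve; so no node on the
   main path is labeled E, and the main path is properly 3-colored.  Each block
   can carry its own set of consecutive identifiers, hence Linial's bound for
   the 3-coloring of a path applies, with as many identifiers as there are
   blocks, that is n / T^O(k). *)

Set Implicit Arguments.
Unset Strict Implicit.
Unset Printing Implicit Defensive.

(** * Iterated logarithms and levels *)

(** Optimality is pointwise in [n], so the lower bound must hold for each single [n]: it bounds [n]
    by a tower of exponentials of height [2 * T n] plus a constant. The hard instances have exactly
    [n] nodes because they are prefixes of an infinite tree numbered with parents before children.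
    The cut at [n] and the ends of paths disturb levels only nearby, hence the notion of deep nodes
    with margin [k.+1]. The absence of E is proved for all identifier assignments at once, since the
    parity argument compares two of them. Consecutive identifiers inside a block make the view of a
    node on the main path depend only on the numbers of the blocks it sees, whatever hangs from that
    path. The blocks grow with [T], but this costs only a bounded number of additional exponentials,
    which log* does not notice. *)

Lemma up_logM_leq m n : up_log 2 (m * n) <= up_log 2 m + up_log 2 n.
Proof.
by apply: up_log_min => //; rewrite expnD leq_mul // up_logP.
Qed.

Lemma iter_up_log_leq i n : iter i (up_log 2) n <= maxn 1 (n - i).
Proof.
elim: i => [|i IHi] /=; first by lia.
apply: up_log_min => //.
have : maxn 1 (n - i) <= 2 ^ maxn 1 (n - i.+1).
  by have := @ltn_expl 2 (maxn 1 (n - i.+1)) isT; lia.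
by apply: leq_trans.
Qed.

Lemma iter_up_log_logstar n : iter (logstar n) (up_log 2) n <= 1.
Proof.
pose P i := iter i (up_log 2) n <= 1.
have hasP : has P (iota 0 n.+1).
  apply/hasP; exists n; first by rewrite mem_iota; lia.
  by rewrite /P; have := iter_up_log_leq n n; lia.
have := nth_find 0 hasP; rewrite nth_iota //.
by move: hasP; rewrite has_find size_iota.
Qed.

Lemma logstar_gt0 n : 1 < n -> 0 < logstar n.
Proof. by rewrite /logstar /=; case: ifP => // /=; lia. Qed.

Definition tower i m := iter i (expn 2) m.

Lemma leq_tower_logstar i n : n <= tower i 1 -> logstar n <= i.
Proof.
move=> le_n; rewrite /logstar.
have le1 j m : m <= tower j 1 -> iter j (up_log 2) m <= 1.
  elim: j m => [|j IHj] m //= le_m.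
  by rewrite -iterS iterSr; apply: IHj; apply: up_log_min.
have [lt_in|] := ltnP i n.+1; last first.
  by apply: leq_trans; rewrite -[X in _ <= X](size_iota 0) find_size.
rewrite leqNgt; apply/negP => /(before_find 0).
by rewrite nth_iota // add0n le1.
Qed.

Section LevelTheory.

Variables (V : finType) (e : rel V).

(** Levels are defined by a search over the layers; membership in [remaining] is the form that an
    induction over the peeling steps can follow. *)
Lemma ltn_level k i v : i <= k -> (i < level e k v) = (v \in remaining e i).
Proof.
move=> le_ik; rewrite /level ltnS.
have remP : (v \in remaining e i) = ~~ has (fun j => v \in layer e j) (iota 1 i).
  elim: i {le_ik} => [|i IHi]; first by rewrite in_setT.
  rewrite -addn1 iotaD has_cat negb_or -IHi /= orbF add1n addn1 /layer /=.
  by rewrite in_setD andbC.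
rewrite remP -[in LHS](subnKC le_ik) iotaD find_cat.
case: ifP => [hasi|_]; last by rewrite size_iota leq_addr.
by rewrite leqNgt -[X in _ < X](size_iota 1) -has_find hasi.
Qed.

Lemma level_gt0 k v : 0 < level e k v.
Proof. by []. Qed.

End LevelTheory.

(** * The optimal complexity of a problem *)

Section Execution.

Variables (Out : Type) (A : algorithm Out) (G : network).

Lemma output_at_leq t t' (v : node G) o :
  t <= t' -> output_at A t v = Some o -> output_at A t' v = Some o.
Proof.
move=> /subnKC <-; elim: (t' - t) => [|d IHd]; first by rewrite addn0.
by rewrite addnS /output_at /= => /IHd; rewrite /output_at => out_v; rewrite out_v.
Qed.

Lemma all_terminated_rounds t :
  all_terminated A G t -> exists2 t', rounds A G t' & t' <= t.
Proof.
move=> term_t.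
have ex_t : exists s, `[< all_terminated A G s >] by exists t; apply/asboolP.
case: (ex_minnP ex_t) => t' /asboolP term_t' min_t'.
exists t'; last by apply: min_t'; apply/asboolP.
by split=> // s /asboolP/min_t'.
Qed.

End Execution.

Section Existence.

Variables (Out : Type) (P : problem Out) (Delta c : nat).

Definition solves_at n (A : algorithm Out) : Prop :=
  forall G, tree_instance Delta c n G ->
  exists t (out : node G -> Out),
    (forall v, output_at A t v = Some (out v)) /\ P (@adj G) out.

Definition worst_case n (A : algorithm Out) t : Prop :=
  (forall G, tree_instance Delta c n G ->
     exists2 s, rounds A G s & s <= t) /\
  (exists2 G, tree_instance Delta c n G & rounds A G t).

(** On [n]-node networks only the machine [A n] matters. Isolating it lets each [n] have its own
    optimum, without transporting states along [#|node G| = n]. *)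
Definition const_alg (M : machine Out) : algorithm Out := fun=> M.

Lemma solves_at_const (A : algorithm Out) n :
  solves_at n (const_alg (A n)) <-> solves_at n A.
Proof.
by split=> solA G instG; have [t [out]] := solA G instG;
   case: instG => eq_n *; subst n; exists t, out.
Qed.

Lemma worst_case_const (A : algorithm Out) n t :
  worst_case n (const_alg (A n)) t <-> worst_case n A t.
Proof.
have rndE G s : tree_instance Delta c n G ->
  rounds (const_alg (A n)) G s <-> rounds A G s.
  by move=> instG; rewrite -(card_node instG).
by split=> -[maxA [G instG rG]]; split;
  first [ by move=> H instH; have [s /(rndE _ _ instH)] := maxA H instH; exists s
        | by exists G => //; apply/rndE ].
Qed.

Hypothesis ex_instance :
  forall n, 0 < n -> exists G, tree_instance Delta c n G.

Lemma worst_case_exists n (A : algorithm Out) b : 0 < n ->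
    (forall G, tree_instance Delta c n G -> all_terminated A G b) ->
  exists2 t, worst_case n A t & t <= b.
Proof.
move=> n_gt0 term_b.
pose Q t := `[< exists2 G, tree_instance Delta c n G & rounds A G t >].
have Q_leq t : Q t -> t <= b.
  by move=> /asboolP[G /term_b termG [_ min_t]]; apply: min_t.
have exQ : exists t, Q t.
  have [G instG] := ex_instance n_gt0.
  have [t rt _] := all_terminated_rounds (term_b G instG).
  by exists t; apply/asboolP; exists G.
case: (ex_maxnP exQ Q_leq) => t Qt max_t; exists t; last exact: Q_leq.
split; last by move/asboolP: Qt.
move=> G instG; have [s rs _] := all_terminated_rounds (term_b G instG).
by exists s => //; apply: max_t; apply/asboolP; exists G.
Qed.

Lemma problem_complexity_exists (A : algorithm Out) (b : nat -> nat) :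
    solves P Delta c A ->
    (forall n G, tree_instance Delta c n G -> all_terminated A G (b n)) ->
  exists2 T, problem_complexity P Delta c T & forall n, 0 < n -> T n <= b n.
Proof.
move=> solA term_b.
pose Q n t := `[< exists2 M, solves_at n (const_alg M)
                           & worst_case n (const_alg M) t >].
have QA n B t : solves_at n B -> worst_case n B t -> Q n t.
  move=> solB worstB; apply/asboolP; exists (B n).
    exact/solves_at_const.
  exact/worst_case_const.
(* Choice picks for each [n] a machine of least worst case; together these machines form the optimal
   algorithm. At [n = 0], where nothing is required, [A 0] is a filler. *)
have [f fP] : {f : nat -> machine Out * nat & forall n, 0 < n ->
    [/\ solves_at n (const_alg (f n).1), worst_case n (const_alg (f n).1) (f n).2
      & forall t, Q n t -> (f n).2 <= t] }.
  apply: (@choice _ _ (fun n Mt => 0 < n ->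
    [/\ solves_at n (const_alg Mt.1), worst_case n (const_alg Mt.1) Mt.2
      & forall t, Q n t -> Mt.2 <= t])) => n.
  have [->|n_gt0] := posnP n; first by exists (A 0, 0).
  have exQ : exists t, Q n t.
    have [t worstA _] := worst_case_exists n_gt0 (@term_b n).
    by exists t; apply: QA worstA; apply: solA.
  case: (ex_minnP exQ) => t /asboolP[M solM worstM] min_t.
  by exists (M, t).
pose C n := (f n).1.
exists (fun n => (f n).2).
  split.
    exists C.
      move=> n G instG; have n_gt0 : 0 < n.
        by rewrite -(card_node instG); case: (adj_tree instG).
      have [solC _ _] := fP n n_gt0.
      by move/(@solves_at_const C)/(_ G instG): solC.
    by move=> n /fP[_ /(@worst_case_const C)].
  move=> B T' solB worstB n n_gt0; have [_ _] := fP n n_gt0; apply.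
  by apply: QA (worstB n n_gt0); apply: solB.
move=> n n_gt0; have [t worstA le_t] := worst_case_exists n_gt0 (@term_b n).
apply: leq_trans le_t; have [_ _] := fP n n_gt0; apply.
by apply: QA worstA; apply: solA.
Qed.

End Existence.

(** * Upper bound *)

Section Broadcast.

Variables (Out St : Type) (ini : nat -> nat -> St).
Variables (upd : nat -> St -> seq St -> St) (out : St -> Out) (Tend : nat).

Definition broadcast_machine : machine Out :=
  @Machine Out (nat * St) St (fun i d => (0, ini i d)) (fun s _ => s.2)
    (fun s ms => (s.1.+1, upd s.1 s.2 ms))
    (fun s => if s.1 == Tend then Some (out s.2) else None).

Variable G : network.

Fixpoint broadcast (t : nat) (v : node G) : St :=
  if t is t'.+1 then
    upd t' (broadcast t' v) [seq broadcast t' u | u <- ports v]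
  else ini (ident v) (size (ports v)).

Lemma run_broadcast (A : algorithm Out) t (v : node G) :
    A #|node G| = broadcast_machine -> t <= Tend ->
  (if t == Tend then output_at A t v = Some (out (broadcast t v))
   else output_at A t v = None).
Proof.
rewrite /output_at => eqA.
(* The type of states depends on [A #|node G|]; only the output, whose type does not, is carried
   along [eqA]. *)
suff runE : t <= Tend ->
    @run _ (const_alg broadcast_machine) G t v = (t, broadcast t v).
  move=> le_t; have outE : output (@run _ (const_alg broadcast_machine) G t v)
      = if t == Tend then Some (out (broadcast t v)) else None by rewrite runE.
  by move: outE; rewrite -eqA => ->; case: eqP.
elim: t v => [|t IHt] v lt_t //=.
rewrite IHt ?(ltnW lt_t) //= ifN ?neq_ltn ?lt_t //; congr (_, upd _ _ _).
by apply: eq_map => u; rewrite IHt // ltnW.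
Qed.

End Broadcast.

(** * Color reduction in maximum degree 2 *)

Section ColorReduction.

Definition bit (i x : nat) : nat := odd (x %/ 2 ^ i).

Lemma bit_lt i x : bit i x < 2. Proof. by rewrite /bit; case: odd. Qed.

Lemma bit_inj b x y : x < 2 ^ b -> y < 2 ^ b ->
  (forall i, i < b -> bit i x = bit i y) -> x = y.
Proof.
elim: b x y => [|b IHb] x y lt_x lt_y eq_xy; first by lia.
have odd_xy : odd x = odd y.
  by have := eq_xy 0 isT; rewrite /bit !divn1; do 2!case: odd.
suff : x./2 = y./2 by move=> eq2; rewrite -(odd_double_half x) odd_xy eq2 odd_double_half.
apply: IHb; [by move: lt_x; rewrite expnS; lia | by move: lt_y; rewrite expnS; lia |].
move=> i lt_i; have := eq_xy i.+1 lt_i.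
by rewrite /bit -!divn2 -!divnMA expnS.
Qed.

(** The search returns [b] if no bit differs; for positive [b] the modulo turns this into a valid
    index. *)
Definition diff_bit (b x y : nat) : nat :=
  find (fun i => bit i x != bit i y) (iota 0 b) %% b.

Lemma diff_bit_lt b x y : 0 < b -> diff_bit b x y < b.
Proof. exact: ltn_pmod. Qed.

Lemma diff_bitP b x y : x < 2 ^ b -> y < 2 ^ b -> x <> y ->
  bit (diff_bit b x y) x != bit (diff_bit b x y) y.
Proof.
move=> lt_x lt_y ne_xy; pose P i := bit i x != bit i y.
have hasP : has P (iota 0 b).
  apply/negPn/negP => /hasPn Pn; apply: ne_xy; apply: (@bit_inj b) => // i lt_i.
  by apply/eqP; have := Pn i; rewrite mem_iota lt_i negbK => ->.
have := nth_find 0 hasP; have := hasP; rewrite has_find size_iota => ltP.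
by rewrite /diff_bit modn_small // nth_iota.
Qed.

Definition tagged_bit (b x y : nat) : nat :=
  let i := diff_bit b x y in 2 * i + bit i x.

Lemma tagged_bit_lt b x y : 0 < b -> tagged_bit b x y < 2 * b.
Proof.
move=> b_gt0; rewrite /tagged_bit.
have := diff_bit_lt x y b_gt0; have := bit_lt (diff_bit b x y) x; lia.
Qed.

(** This is the Cole-Vishkin argument: equal tags have equal indices and bits, but at the index
    where [x] is compared with [y] the bits differ. Hence [y] may have chosen its own index against
    any [z]. *)
Lemma tagged_bit_neq b x y z : x < 2 ^ b -> y < 2 ^ b -> x <> y ->
  tagged_bit b x y != tagged_bit b y z.
Proof.
move=> lt_x lt_y ne_xy; have := diff_bitP lt_x lt_y ne_xy; rewrite /tagged_bit.
set i := diff_bit b x y; set j := diff_bit b y z => ne_bit.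
apply/eqP => eq_ij; have eq_i : i = j.
  by have := bit_lt i x; have := bit_lt j y; lia.
by move: ne_bit; rewrite eq_i; apply/negP; rewrite negbK; apply/eqP;
move: eq_ij; rewrite eq_i; lia.
Qed.

(* The new color stores, for each of the two neighbors, the index of a bit that
   distinguishes the old colors, together with that bit; so it differs from any
   new color of that neighbor, in whatever order the neighbor lists its own. *)
Definition reduce (b x : nat) (ys : seq nat) : nat :=
  tagged_bit b x (nth x ys 0) + 2 * b * tagged_bit b x (nth x ys 1).

(** A reduced color is a pair of tags below [2 * b], and [2 * b <= 2 ^ (up_log 2 b).+1]. *)
Definition next_bits (b : nat) : nat := 2 * (up_log 2 b).+1.

Lemma reduce_lt b x ys : 0 < b -> reduce b x ys < 2 ^ next_bits b.
Proof.
move=> b_gt0; apply: (@leq_trans ((2 * b) * (2 * b))).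
  rewrite /reduce; have := tagged_bit_lt x (nth x ys 0) b_gt0.
  by have := tagged_bit_lt x (nth x ys 1) b_gt0; nia.
rewrite mulnn /next_bits [2 * _.+1]mulnC expnM leq_sqr expnS leq_mul2l /=.
exact: up_logP.
Qed.

Lemma reduce_neq b x y xs ys : 0 < b -> x < 2 ^ b -> y < 2 ^ b -> x <> y ->
    size xs <= 2 -> size ys <= 2 -> y \in xs -> x \in ys ->
  reduce b x xs <> reduce b y ys.
Proof.
move=> b_gt0 lt_x lt_y ne_xy; rewrite /reduce => le_xs le_ys y_xs x_ys eq_r.
have [eq0 eq1] : tagged_bit b x (nth x xs 0) = tagged_bit b y (nth y ys 0)
              /\ tagged_bit b x (nth x xs 1) = tagged_bit b y (nth y ys 1).
  have := tagged_bit_lt x (nth x xs 0) b_gt0.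
  have := tagged_bit_lt y (nth y ys 0) b_gt0.
  move: eq_r; set p := tagged_bit _ _ _; set q := tagged_bit _ _ _.
  set r := tagged_bit _ _ _; set s := tagged_bit _ _ _ => eq_r lt_r lt_p.
  have eq_pr : p = r.
    have modE a a' : a < 2 * b -> (a + 2 * b * a') %% (2 * b) = a.
      by move=> lt_a; rewrite addnC mulnC modnMDl modn_small.
    by rewrite -(modE p q) // -(modE r s) // eq_r.
  split=> //; move: eq_r; rewrite eq_pr => /addnI/eqP.
  by rewrite eqn_pmul2l ?muln_gt0 // => /eqP.
have := tagged_bit_neq _ lt_x lt_y ne_xy.
case: xs le_xs y_xs eq0 eq1 {eq_r} => [|x0 [|x1 []]] //= _; rewrite !inE.
  by move=> /eqP <- eq0 _ /(_ (nth y ys 0)); rewrite eq0 eqxx.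
case/orP=> /eqP <- eq0 eq1 ne_t.
  by have := ne_t (nth y ys 0); rewrite eq0 eqxx.
by have := ne_t (nth y ys 1); rewrite eq1 eqxx.
Qed.

(** The factor [2 ^ d] absorbs the constants: a step gives at most [2 * (d + m + 1)] with [m >= 1],
    and [4 + 2 * d <= 2 ^ d] from [d = 4] on. *)
Lemma iter_next_bits d n b i : 4 <= d -> b <= 2 ^ d * maxn 1 (up_log 2 n) ->
  iter i next_bits b <= 2 ^ d * maxn 1 (iter i.+1 (up_log 2) n).
Proof.
move=> d_ge4 le_b; elim: i => [|i IHi] //=; rewrite {1}/next_bits.
set l := iter i.+1 (up_log 2) n in IHi *.
have le_up : up_log 2 (iter i next_bits b) <= d + maxn 1 (up_log 2 l).
  apply: leq_trans (leq_up_log 2 IHi) _; apply: leq_trans (up_logM_leq _ _) _.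
  apply: leq_add; first exact: up_log_min.
  apply: up_log_min => //; rewrite geq_max expn_gt0 /=.
  apply: leq_trans (@up_logP 2 l isT) _; apply: leq_pexp2l => //; exact: leq_maxr.
have d_exp : 4 + 2 * d <= 2 ^ d.
  move: d_ge4; elim: (d) => // m IHm; rewrite leq_eqVlt => /predU1P[<- //|lt_m].
  by rewrite expnS; have := IHm lt_m; lia.
move: (maxn _ _) (leq_maxl 1 (up_log 2 l)) le_up => m; nia.
Qed.

Definition free_color (ys : seq nat) : nat := find [pred x | x \notin ys] (iota 0 3).

Lemma free_colorP ys : size ys <= 2 -> free_color ys < 3 /\ free_color ys \notin ys.
Proof.
move=> le_ys; have hasP : has [pred x | x \notin ys] (iota 0 3).
  apply/negPn/negP => /hasPn sub; have : size (iota 0 3) <= size ys.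
    by apply: uniq_leq_size => // x /sub /=; rewrite negbK.
  by rewrite size_iota; lia.
have := nth_find 0 hasP; have := hasP; rewrite has_find size_iota => ltP.
by rewrite /free_color nth_iota.
Qed.

(** The guard protects the colors 0, 1 and 2 in the last rounds, when [q] reaches them. *)
Definition remove_color (q x : nat) (ys : seq nat) : nat :=
  if (x == q) && (2 < q) then free_color ys else x.

End ColorReduction.

(** * Peeling, then 3-coloring level [k] *)

Section ColoringAlgorithm.

Variables k c n : nat.

Definition color_bits (i : nat) : nat := iter i next_bits (c * up_log 2 n).+1.

(** The exponent is [2 ^ d] for [d = c + 4], which satisfies [4 <= d] and [c.+1 <= 2 ^ d] as
    [iter_next_bits] needs for identifiers up to [n ^ c]. *)
Definition palette : nat := 2 ^ (2 ^ (c + 4)).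

Lemma color_bits_gt0 i : 0 < color_bits i.
Proof. by case: i. Qed.

Lemma color_bits_logstar : 2 ^ color_bits (logstar n) <= palette.
Proof.
rewrite leq_exp2l //; apply: leq_trans (@iter_next_bits (c + 4) n _ _ _ _) _.
- by rewrite addnC.
- have c_exp : c.+1 <= 2 ^ (c + 4).
    by apply: leq_trans (ltn_expl c (isT : 1 < 2)) _; rewrite leq_pexp2l // leq_addr.
  by move: (maxn _ _) (leq_maxl 1 (up_log 2 n)) (leq_maxr 1 (up_log 2 n)) => m; nia.
rewrite -[X in _ <= X]muln1 leq_mul2l expn_eq0 /= geq_max leqnn /=.
by apply: (@leq_trans (up_log 2 1)); rewrite ?leq_up_log ?iter_up_log_logstar.
Qed.

(* A state is a pair (level, color); level 0 means that the node has not been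
   removed yet. *)
Definition peel (t l : nat) (ms : seq (nat * nat)) : nat :=
  if [&& t < k, l == 0 & count (fun m => m.1 == 0) ms <= 2] then t.+1 else l.

(** Recoloring waits for round [k]: only then is it known which neighbors have level [k]. *)
Definition recolor (t x : nat) (ys : seq nat) : nat :=
  if t < k then x
  else if t < k + logstar n then reduce (color_bits (t - k)) x ys
  else remove_color (palette - (t - (k + logstar n)).+1) x ys.

Definition coloring_step (t : nat) (s : nat * nat) (ms : seq (nat * nat)) :=
  (peel t s.1 ms, recolor t s.2 [seq m.2 | m <- ms & m.1 == k]).

Definition label_of (s : nat * nat) : label :=
  if s.1 == 0 then Exempt else if s.1 < k then Decline
  else if s.2 == 0 then Red else if s.2 == 1 then Green else Yellow.

Definition coloring_time : nat := k + logstar n + palette.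

Definition coloring_machine : machine label :=
  broadcast_machine (fun i _ => (0, i.-1)) coloring_step label_of coloring_time.

Hypothesis k_gt0 : 0 < k.

Variables (Delta : nat) (G : network).
Hypothesis instG : tree_instance Delta c n G.

Let e := @adj G.
Let st := @broadcast _ (fun i _ => (0, i.-1)) coloring_step G.

Let count_ports (a : pred (node G)) (v : node G) :
  count a (ports v) = #|[set u in a | e v u]|.
Proof.
rewrite -size_filter; have uniq_a := filter_uniq a (ports_uniq instG v).
rewrite -(card_uniqP uniq_a); apply: eq_card => u.
by rewrite !inE mem_filter (mem_ports instG).
Qed.

Let st_level t v :
  (st t v).1 = if level e k v <= minn t k then level e k v else 0.
Proof.
elim: t v => [|t IHt] v; first by rewrite min0n leqNgt level_gt0.
rewrite /= -/st /peel count_map; have [lt_tk|le_kt] /= := ltnP t k; last first.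
  by rewrite IHt !(minn_idPr _) // ltnW.
have st0 u : ((st t u).1 == 0) = (u \in remaining e t).
  rewrite IHt (minn_idPl (ltnW lt_tk)) -(ltn_level e u (ltnW lt_tk)) ltnNge.
  by case: leqP.
rewrite st0; set b := (_ <= 2).
have -> : b = (#|[set u in remaining e t | e v u]| <= 2).
  rewrite /b count_ports; congr (_ <= 2); apply: eq_card => u.
  by rewrite !inE /= unfold_in /= st0.
rewrite (minn_idPl lt_tk) IHt (minn_idPl (ltnW lt_tk)).
have := ltn_level e v lt_tk; rewrite /= in_setD /low_degree inE.
have := ltn_level e v (ltnW lt_tk); case: (v \in remaining e t) => /= rem_t.
  by case: (#|_| <= 2) => /= rem_St; do ?case: ifP; lia.
by move=> rem_St; do ?case: ifP; lia.
Qed.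

Let level_k_st t v : k <= t -> ((st t v).1 == k) = (level e k v == k).
Proof.
move=> le_kt; rewrite st_level (minn_idPr le_kt).
by case: ifP => //; have := level_gt0 e k v; lia.
Qed.

Definition level_k_colors t v : seq nat :=
  [seq (st t u).2 | u <- ports v & level e k u == k].

Let st_color t v :
  (st t.+1 v).2 = recolor t (st t v).2
    (if t < k then [::] else level_k_colors t v).
Proof.
rewrite /= -/st /recolor; case: ifP => // ltF.
suff -> : [seq m.2 | m <- [seq st t u | u <- ports v] & m.1 == k]
        = level_k_colors t v by [].
rewrite filter_map -map_comp /level_k_colors; congr map; apply: eq_filter => u /=.
by rewrite level_k_st // leqNgt ltF.
Qed.

(** A node of level [k] has at most two neighbors in [remaining e k.-1], and all nodes of level [k]
    are in this set. *)
Let size_level_k_colors t v : level e k v = k -> size (level_k_colors t v) <= 2.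
Proof.
move=> lv_v; rewrite size_map size_filter count_ports.
have lt_k : k.-1 < k by rewrite prednK.
have rem_v : v \in remaining e k.-1 by rewrite -(@ltn_level _ e k) ?lv_v ?leq_pred.
have : v \notin remaining e k.-1.+1.
  by rewrite prednK // -(@ltn_level _ e k) // lv_v ltnn.
rewrite /= in_setD rem_v andbT negbK inE => /andP[_].
apply: leq_trans; apply: subset_leq_card; apply/subsetP => u; rewrite !inE.
by case/andP=> /eqP lv_u ->; rewrite -(@ltn_level _ e k) ?leq_pred // lv_u lt_k.
Qed.

Let mem_level_k_colors t u v :
  e v u -> level e k u = k -> (st t u).2 \in level_k_colors t v.
Proof.
by move=> e_vu lv_u; apply: map_f; rewrite mem_filter lv_u eqxx (mem_ports instG).
Qed.

Let e_sym : symmetric e. Proof. by case: (adj_tree instG). Qed.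

Definition proper_below t m : Prop :=
  (forall v, level e k v = k -> (st t v).2 < m) /\
  (forall u v, e u v -> level e k u = k -> level e k v = k ->
     (st t u).2 <> (st t v).2).

Let proper_init : proper_below k (2 ^ color_bits 0).
Proof.
have stE t v : t <= k -> (st t v).2 = (ident v).-1.
  by elim: t => [|t IHt] // lt_tk; rewrite st_color /recolor lt_tk IHt // ltnW.
split=> [v lv_v|u v e_uv _ _]; rewrite !stE //.
  have /andP[id_gt0 id_le] := ident_range instG v.
  rewrite prednK //; apply: leq_trans id_le _.
  apply: (@leq_trans (2 ^ (c * up_log 2 n))); last by rewrite leq_exp2l.
  by rewrite mulnC expnM; case: (c) => // c'; rewrite leq_exp2r // up_logP.
move=> eq_id; have uv : u = v.
  apply: (ident_inj instG).
  by have /andP[+ _] := ident_range instG u; have /andP[+ _] := ident_range instG v; lia.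
by case: (adj_tree instG) => _ irr _ _ _; move: e_uv; rewrite uv /e irr.
Qed.

Let proper_reduce i : i <= logstar n -> proper_below (k + i) (2 ^ color_bits i).
Proof.
elim: i => [|i IHi] lt_i; first by rewrite addn0.
have [lt_c ne_c] := IHi (ltnW lt_i).
have stE v : (st (k + i.+1) v).2
    = reduce (color_bits i) (st (k + i) v).2 (level_k_colors (k + i) v).
  by rewrite addnS st_color /recolor ltnNge leq_addr /= ltn_add2l lt_i addKn.
split=> [v lv_v|u v e_uv lv_u lv_v]; rewrite !stE.
  exact: reduce_lt (color_bits_gt0 i).
apply: reduce_neq; rewrite ?color_bits_gt0 ?lt_c ?size_level_k_colors //.
- exact: ne_c.
- exact: mem_level_k_colors.
- by apply: mem_level_k_colors => //; rewrite e_sym.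
Qed.

(** At level [k] the nodes of the removed color are pairwise nonadjacent, so they recolor in the
    same round; each avoids the colors of its neighbors there, which keep them. *)
Let proper_remove j : j <= palette ->
  proper_below (k + logstar n + j) (maxn 3 (palette - j)).
Proof.
elim: j => [|j IHj] lt_j.
  have [lt_c ne_c] := proper_reduce (leqnn _); rewrite addn0 subn0; split=> // v /lt_c.
  by have := color_bits_logstar; lia.
have [lt_c ne_c] := IHj (ltnW lt_j); set t := _ + j in lt_c ne_c *.
have stE v : (st t.+1 v).2
    = remove_color (palette - j.+1) (st t v).2 (level_k_colors t v).
  rewrite st_color /recolor /t.
  have -> : (k + logstar n + j < k) = false by lia.
  have -> : (k + logstar n + j < k + logstar n) = false by lia.
  by rewrite addKn.
rewrite addnS -/t; split=> [v lv_v|u v e_uv lv_u lv_v]; rewrite !stE /remove_color.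
  have := lt_c _ lv_v; have [] := free_colorP (size_level_k_colors t lv_v).
  by case: ifP; lia.
have := ne_c _ _ e_uv lv_u lv_v.
have := mem_level_k_colors t e_uv lv_v.
have : e v u by rewrite e_sym.
move=> /mem_level_k_colors-/(_ t lv_u).
have [_] := free_colorP (size_level_k_colors t lv_v).
have [_] := free_colorP (size_level_k_colors t lv_u).
move=> nu nv mu mv.
case: ifP => [/andP[/eqP-> _]|_]; case: ifP => [/andP[/eqP-> _]|_] // _ eq_c.
  by move: nu; rewrite eq_c mv.
by move: nv; rewrite -eq_c mu.
Qed.

Lemma coloring_correct :
  hierarchical_3half_coloring k e (fun v => label_of (st coloring_time v)).
Proof.
have [lt_c ne_c] := proper_remove (leqnn palette).
have st1 v : (st coloring_time v).1 = if level e k v <= k then level e k v else 0.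
  by rewrite st_level (minn_idPr _) // /coloring_time -addnA leq_addr.
have lo_v v : level e k v < k -> label_of (st coloring_time v) = Decline.
  move=> lt_v; rewrite /label_of st1 (ltnW lt_v) lt_v.
  by case: eqP (level_gt0 e k v) => // ->.
have k_v v : level e k v = k -> label_of (st coloring_time v)
    = let x := (st coloring_time v).2 in
      if x == 0 then Red else if x == 1 then Green else Yellow.
  by move=> lv_v; rewrite /label_of st1 lv_v leqnn ltnn gtn_eqF.
have not_WBE u : level e k u <= k -> [\/ label_of (st coloring_time u) = White,
    label_of (st coloring_time u) = Black
  | label_of (st coloring_time u) = Exempt] -> False.
  rewrite leq_eqVlt => /predU1P[/k_v->|/lo_v->]; last by case.
  by rewrite /=; do ?case: ifP => _; case.
split.
- move=> v lv_v E_v; apply: (@not_WBE v); first by rewrite lv_v.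
  exact: Or33.
- by move=> v lv_v; rewrite /label_of st1 lv_v ltnn.
- move=> v /andP[_ le_v]; split=> [E_v|[u [_ lt_u] /not_WBE []]]; last by lia.
  by case: (@not_WBE v) => //; apply: Or33.
- by move=> v /andP[_ /lo_v->].
- by move=> v /andP[_ /lo_v->].
- by move=> v /andP[_ /lo_v->].
- by move=> v /k_v->; rewrite /=; do ?case: ifP => _.
- move=> u v e_uv lv_u lv_v _; rewrite !k_v //.
  have := ne_c _ _ e_uv lv_u lv_v; have := lt_c _ lv_u; have := lt_c _ lv_v.
  rewrite subnn -/coloring_time /=.
  by move: (st _ u).2 (st _ v).2 => [|[|[|x]]] [|[|[|y]]].
Qed.

End ColoringAlgorithm.

Definition coloring_algorithm (k c : nat) : algorithm label := coloring_machine k c.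

Lemma coloring_output k Delta c n G : 0 < k -> tree_instance Delta c n G ->
  exists out : node G -> label,
    (forall v, output_at (coloring_algorithm k c) (coloring_time k c n) v
               = Some (out v)) /\
    hierarchical_3half_coloring k (@adj G) out.
Proof.
move=> k_gt0 instG; have correct := coloring_correct k_gt0 instG.
eexists; split; last exact: correct.
move=> v; have := @run_broadcast _ _ (fun i _ => (0, i.-1)) (coloring_step k c n)
  (label_of k) (coloring_time k c n) G (coloring_algorithm k c) (coloring_time k c n) v.
rewrite eqxx; apply=> //.
by rewrite -[in RHS](card_node instG).
Qed.

(** * Lower bound *)

(* Linial: from a coloring of [t.+1]-windows one gets a coloring of [t]-windows
   by the set of the colors of all extensions of the window to the right. *)
Lemma linial (C : finType) (F : seq nat -> C) t N :
    (forall w, size w = t.+2 -> sorted ltn w -> all (gtn N) w ->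
       F (take t.+1 w) <> F (behead w)) ->
  N <= tower t #|C|.
Proof.
elim: t C F => [|t IHt] C F ne_F.
  have inj_F : injective (fun i : 'I_N => F [:: val i]).
    move=> i j eq_F; apply: val_inj; apply/eqP; rewrite eqn_leq.
    have noF (u v : 'I_N) : F [:: val u] = F [:: val v] -> v <= u.
      move=> eq_uv; rewrite leqNgt; apply/negP => lt_uv.
      by apply: (ne_F [:: val u; val v]); rewrite //= ?lt_uv ?ltn_ord.
    by rewrite !noF.
  by have := leq_card _ inj_F; rewrite card_ord.
have -> : tower t.+1 #|C| = tower t #|{set C}|.
  by rewrite /tower iterSr -[in RHS]cardsT -powersetT card_powerset cardsT.
pose F' w := [set x | `[< exists2 a, last 0 w < a < N & F (rcons w a) = x >]].
apply: (IHt _ F') => w size_w sorted_w lt_w eq_F'.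
case/lastP def_w: w size_w => [//|v a] size_w.
have size_v : size v = t.+1 by move: size_w; rewrite size_rcons => -[].
have last_v x : last x w = a by rewrite def_w last_rcons.
have take_w : take t.+1 w = v by rewrite def_w -cats1 take_size_cat.
(* The last entry of [w] extends [take t.+1 w]. If both sets were equal, some [a'] would extend
   [behead w] with the same color, and [rcons w a'] would violate [ne_F]. *)
have : F w \in F' (take t.+1 w).
  rewrite inE take_w; apply/asboolP; exists a; last by rewrite def_w.
  have lt_a : a < N by apply: (allP lt_w); rewrite def_w mem_rcons mem_head.
  rewrite lt_a andbT; case: v size_v def_w {size_w take_w} => // x v _ def_w.
  by move: sorted_w; rewrite def_w /= rcons_path => /andP[].
rewrite eq_F' inE => /asboolP[a' /andP[lt_aa' lt_a'] eq_F].
have size_w' : size w = t.+2 by rewrite def_w.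
have {}lt_aa' : a < a'.
  by move: lt_aa'; rewrite -(last_v 0); case: (w) size_w' => // x [].
apply: (ne_F (rcons w a')).
- by rewrite size_rcons size_w'.
- case: (w) sorted_w last_v => // x s sorted_s last_v.
  by rewrite /= rcons_path; move: (last_v 0) => /= ->; apply/andP.
- by rewrite all_rcons lt_w andbT.
have -> : take t.+2 (rcons w a') = w by rewrite -cats1 take_size_cat.
by rewrite -eq_F; case: (w) size_w'.
Qed.

(** * Trees given by a parent function *)

Section ParentTree.

Variables (n : nat) (par : nat -> nat).
Hypothesis par_lt : forall v, 0 < v -> par v < v.

Definition parent_rel (u v : 'I_n) : bool :=
  ((0 < v) && (par v == u)) || ((0 < u) && (par u == v)).

Lemma parent_rel_sym : symmetric parent_rel.
Proof. by move=> u v; rewrite /parent_rel orbC. Qed.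

Lemma parent_rel_lt u v : parent_rel u v -> u < v -> par v = u.
Proof.
case/orP=> /andP[gt0 /eqP par_v] lt_uv //.
by have := par_lt gt0; rewrite par_v ltnNge (ltnW lt_uv).
Qed.

Lemma parent_rel_irr : irreflexive parent_rel.
Proof.
move=> v; rewrite /parent_rel orbb; apply/negP => /andP[/par_lt lt_v /eqP eq_v].
by rewrite eq_v ltnn in lt_v.
Qed.

(* The two neighbors in a cycle of its largest vertex would both be its parent. *)
Lemma parent_rel_acyclic (s : seq 'I_n) : ucycle parent_rel s -> size s <= 2.
Proof.
move=> /andP[cyc_s uniq_s]; rewrite leqNgt; apply/negP => gt2.
have [x x_s max_x] : exists2 x, x \in s & forall y, y \in s -> y <= x.
  case: s {cyc_s uniq_s} gt2 => // x0 s _.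
  exists [arg max_(x > x0 in x0 :: s) val x]; case: arg_maxnP => //; first exact: mem_head.
  by rewrite mem_head.
have := rot_index x_s; set s' := _ ++ _; move=> rot_s.
have cyc' : cycle parent_rel (x :: s') by rewrite -rot_s rot_cycle.
have uniq' : uniq (x :: s') by rewrite -rot_s rot_uniq.
have size' : size (x :: s') = size s by rewrite -rot_s size_rot.
have max' y : y \in x :: s' -> y <= x by rewrite -rot_s mem_rot => /max_x.
case: s' {rot_s} cyc' uniq' size' max' => [_ _ /= eq1|y s'].
  by rewrite -eq1 in gt2.
case/lastP: s' => [_ _ /= eq2|s' z]; first by rewrite -eq2 in gt2.
rewrite /= rcons_path last_rcons => /andP[xy /andP[_ zx]] uniq' _ max'.
have lt_x w : w \in y :: rcons s' z -> w < x.
  move=> w_s; rewrite ltn_neqAle (max' w (mem_behead (s := x :: _) w_s)) andbT.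
  by case/andP: uniq' => + _; apply: contraNneq => /val_inj <-.
have y_s : y \in y :: rcons s' z by rewrite mem_head.
have z_s : z \in y :: rcons s' z by rewrite inE mem_rcons mem_head orbT.
have eq_yz : y = z.
  apply: val_inj; rewrite /= -(parent_rel_lt zx (lt_x _ z_s)).
  by rewrite (parent_rel_lt _ (lt_x _ y_s)) // parent_rel_sym.
by case/and3P: uniq' => _; rewrite eq_yz mem_rcons mem_head.
Qed.

Lemma parent_rel_tree : 0 < n -> is_tree parent_rel.
Proof.
move=> n_gt0; split.
- exact: parent_rel_sym.
- exact: parent_rel_irr.
- by rewrite card_ord.
- have to0 m (v : 'I_n) : v = m :> nat -> connect parent_rel (Ordinal n_gt0) v.
    elim/ltn_ind: m v => m IHm v def_m; have [v0|v_gt0] := posnP v.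
      by rewrite (_ : Ordinal _ = v) ?connect0 //; apply: val_inj.
    have lt_p := par_lt v_gt0; have lt_n := ltn_trans lt_p (ltn_ord v).
    have lt_m : par v < m by rewrite -def_m.
    apply: connect_trans (IHm _ lt_m (Ordinal lt_n) erefl) _.
    by apply: connect1; rewrite /parent_rel /= v_gt0 eqxx.
  move=> u v; apply: connect_trans (to0 v v erefl).
  by rewrite (sym_connect_sym parent_rel_sym) (to0 u).
- exact: parent_rel_acyclic.
Qed.

End ParentTree.

(** * Executions on natural numbers and their translations *)

Section NatRun.

Variables (Out : Type) (M : machine Out) (nb : nat -> seq nat).

Fixpoint nat_run (ids : nat -> nat) (t v : nat) : state M :=
  if t is t'.+1 then
    let s := nat_run ids t' v in
    if output s is Some _ then s
    else recv s [seq send (nat_run ids t' u) (index v (nb u)) | u <- nb v]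
  else init M (ids v) (size (nb v)).

(** [Z s v] marks the nodes whose states after [s] rounds have to match. Port numbers match too,
    since translating a list of neighbors keeps positions. *)
Lemma nat_run_shift d (Z : nat -> nat -> Prop) ids ids' t u :
    (forall s v, Z s v -> nb (v + d) = [seq w + d | w <- nb v] /\ ids' (v + d) = ids v) ->
    (forall s v, Z s.+1 v -> Z s v /\ forall w, w \in nb v -> Z s w) ->
  Z t u -> nat_run ids' t (u + d) = nat_run ids t u.
Proof.
move=> nbZ subZ; elim: t u => [|t IHt] u Zu /=.
  by have [-> ->] := nbZ _ _ Zu; rewrite size_map.
have [Zu' Zw] := subZ _ _ Zu; rewrite IHt //; case: output => //.
have [-> _] := nbZ _ _ Zu'; rewrite -map_comp; congr (recv _ _).
apply/eq_in_map => w /Zw Zw' /=; rewrite IHt //.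
by have [-> _] := nbZ _ _ Zw'; rewrite (index_map (@addIn d)).
Qed.

End NatRun.

(** * The nested paths and the views in them *)

Section NestedPaths.

Variables k L : nat.

(* A block of type [j] consists of a root followed, for [j > 1], by [L]
   consecutive blocks of type [j - 1], whose roots form a path starting next to
   the root.  The tree consists of consecutive blocks of type [k], whose roots
   form a path. *)
Fixpoint block_size (j : nat) : nat :=
  if j is j'.+1 then (L * block_size j').+1 else 0.

(** Locates offset [o] of the block of index [i] in a path of type [j]. The pair [(0, 0)] is a
    default, never reached when [o < block_size j]. *)
Fixpoint block_coord (j i o : nat) : nat * nat :=
  if o is o'.+1 then
    if j is j'.+1 then block_coord j' (o' %/ block_size j') (o' %% block_size j')
    else (0, 0)
  else (j, i).

(* Type of a node, and its index in the path of its type. *)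
Definition coord (v : nat) : nat * nat :=
  block_coord k (v %/ block_size k) (v %% block_size k).

Definition index_ok (j i : nat) : bool := (j == k) || (i < L).

(** The numbering is depth-first, so the first root of a subordinate path directly follows its
    parent. At node 0 the subtraction returns 0, which [parent_rel] ignores. *)
Definition parent (v : nat) : nat :=
  let: (j, i) := coord v in
  if (j < k) && (i == 0) then v.-1 else v - block_size j.

(* [nested_path y j] : the node [y] is the first one of a path of type [j]. *)
Inductive nested_path : nat -> nat -> Prop :=
| NestedTop : nested_path 0 k
| NestedSub y j i : nested_path y j.+1 -> index_ok j.+1 i ->
    nested_path (y + i * block_size j.+1).+1 j.

Hypotheses (k_gt0 : 0 < k) (L_gt0 : 0 < L).

Lemma block_size_gt0 j : 0 < j -> 0 < block_size j.
Proof. by case: j. Qed.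

Lemma leq_block_size i j : i <= j -> block_size i <= block_size j.
Proof.
move=> /subnKC <-; elim: (j - i) => [|d IHd]; first by rewrite addn0.
by rewrite addnS /=; nia.
Qed.

Lemma nested_path_leq y j : nested_path y j -> j <= k.
Proof. by elim=> // y' j' i _ /ltnW. Qed.

Lemma nested_path_coord y j i o : nested_path y j -> index_ok j i ->
  o < block_size j -> coord (y + i * block_size j + o) = block_coord j i o.
Proof.
move=> yP; elim: yP i o => [|{}y {}j i0 yP IHy ok_i0] i o ok_i lt_o.
  by rewrite add0n /coord divnMDl ?modnMDl ?divn_small ?modn_small ?addn0 //
    (leq_ltn_trans _ lt_o).
have bs_gt0 : 0 < block_size j by apply: leq_ltn_trans lt_o.
have lt_i : i < L.
  by case/orP: ok_i => // /eqP eq_j; have := nested_path_leq yP; rewrite eq_j ltnn.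
have -> : (y + i0 * block_size j.+1).+1 + i * block_size j + o
    = y + i0 * block_size j.+1 + (i * block_size j + o).+1 by lia.
rewrite IHy //= ?divnMDl ?modnMDl ?divn_small ?modn_small ?addn0 //.
by rewrite ltnS; nia.
Qed.

Lemma nested_path_root y j i : nested_path y j -> index_ok j i -> 0 < j ->
  coord (y + i * block_size j) = (j, i).
Proof.
move=> yP ok_i j_gt0; rewrite -[X in coord X]addn0 nested_path_coord //.
  by case: j j_gt0 {yP ok_i}.
exact: block_size_gt0.
Qed.

Lemma nested_pathP v : exists y j i,
  [/\ nested_path y j, index_ok j i, 0 < j & v = y + i * block_size j].
Proof.
have gen j y i o : nested_path y j -> index_ok j i -> o < block_size j ->
    exists y' j' i', [/\ nested_path y' j', index_ok j' i', 0 < j'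
      & y + i * block_size j + o = y' + i' * block_size j'].
  elim: j y i o => // j IHj y i [|o] yP ok_i lt_o.
    by exists y, j.+1, i; rewrite addn0.
  have yP' := NestedSub yP ok_i.
  have bs_gt0 : 0 < block_size j.
    by move: lt_o; rewrite /= ltnS; case: (block_size j); lia.
  have [] := IHj _ (o %/ block_size j) (o %% block_size j) yP'.
  - by apply/orP; right; rewrite ltn_divLR.
  - by rewrite ltn_mod.
  move=> y' [j' [i' [yP'' ok' j'_gt0 eq']]]; exists y', j', i'; split=> //.
  by rewrite -eq' {1}(divn_eq o (block_size j)); lia.
have [] := gen k 0 (v %/ block_size k) (v %% block_size k) NestedTop.
- by rewrite /index_ok eqxx.
- by rewrite ltn_mod block_size_gt0.
by move=> y [j [i]]; rewrite add0n -divn_eq => H; exists y, j, i.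
Qed.

Lemma nested_path_first y j : nested_path y j ->
  (y = 0 /\ j = k) \/
  [/\ j < k, 0 < y & exists2 i, index_ok j.+1 i & coord y.-1 = (j.+1, i)].
Proof.
case=> [|{}y {}j i yP ok_i]; first by left.
right; split=> //; first exact: nested_path_leq yP.
by exists i => //; apply: nested_path_root.
Qed.

Lemma parentE y j i : nested_path y j -> index_ok j i -> 0 < j ->
  parent (y + i * block_size j) =
    if i == 0 then y.-1 else y + i.-1 * block_size j.
Proof.
move=> yP ok_i j_gt0; rewrite /parent nested_path_root //.
have [->|] := eqVneq i 0; last by case: i {ok_i} => // i _; rewrite andbF mulSn; lia.
rewrite andbT mul0n addn0; case: ltnP => // le_kj.
case: (nested_path_first yP) => [[-> _] //|[]]; lia.
Qed.

Lemma parent_lt v : 0 < v -> parent v < v.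
Proof.
have [y [j [i [yP ok_i j_gt0 ->]]]] := nested_pathP v.
rewrite parentE //; case: i {ok_i} => [|i]; first by rewrite mul0n addn0 /=; lia.
by rewrite mulSn /=; have := block_size_gt0 j_gt0; lia.
Qed.

(* Candidate children: the first node of the subordinate path, and the next node
   on the same path. *)
Definition children (v : nat) : seq nat :=
  let: (j, i) := coord v in
  (if 1 < j then [:: v.+1] else [::]) ++
  (if index_ok j i.+1 then [:: v + block_size j] else [::]).

Lemma index_okP j i : index_ok j i.+1 -> index_ok j i.
Proof. by case/orP=> [|/ltnW] ok_i; rewrite /index_ok ok_i ?orbT. Qed.

Lemma index_ok0 j : index_ok j 0.
Proof. by rewrite /index_ok L_gt0 orbT. Qed.

Lemma mem_children u v : (v \in children u) = (0 < v) && (parent v == u).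
Proof.
apply/idP/andP => [|[v_gt0 /eqP <-]].
  have [y [j [i [yP ok_i j_gt0 ->]]]] := nested_pathP u.
  rewrite /children nested_path_root // mem_cat => /orP[].
    case: j yP ok_i j_gt0 => // j yP ok_i _; case: ifP => // j_gt0; rewrite inE => /eqP->.
    have yP' := NestedSub yP ok_i.
    by have := parentE yP' (index_ok0 _) j_gt0; rewrite mul0n addn0 => ->.
  case: ifP => // ok_i1; rewrite inE => /eqP->.
  have -> : y + i * block_size j + block_size j = y + i.+1 * block_size j.
    by rewrite mulSn -addnA [_ + block_size j]addnC.
  rewrite parentE // eqxx mulSn; split=> //; have := block_size_gt0 j_gt0; lia.
have [y [j [i [yP ok_i j_gt0 def_v]]]] := nested_pathP v.
move: v_gt0; rewrite def_v parentE // /children.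
case: i ok_i {def_v} => [|i] ok_i /=.
  rewrite mul0n addn0 => y_gt0.
  case: (nested_path_first yP) => [[]|[_ _ [i _ ->]]]; first by lia.
  by rewrite ltnS j_gt0 prednK // inE eqxx.
move=> _; rewrite (nested_path_root yP (index_okP ok_i)) // mem_cat ok_i.
by rewrite mem_seq1 mulSn [block_size j + _]addnC addnA eqxx orbT.
Qed.

Variable n : nat.
Hypothesis n_gt0 : 0 < n.

(** The main path is infinite and is cut here to the numbers below [n]. Away from the ends, the
    uniform order of the ports makes views invariant under translation by blocks. *)
Definition neighbors (v : nat) : seq nat :=
  (if 0 < v then [:: parent v] else [::]) ++ [seq w <- children v | w < n].

Definition tree_network (ids : nat -> nat) : network :=
  @Network 'I_n (@parent_rel n parent) ids (fun v => pmap insub (neighbors v)).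

Lemma mem_neighbors (u v : 'I_n) :
  (val v \in neighbors u) = parent_rel parent u v.
Proof.
rewrite mem_cat mem_filter ltn_ord mem_children // orbC /parent_rel; congr (_ || _).
by case: ifP => //; rewrite mem_seq1 eq_sym.
Qed.

Lemma neighbors_lt u v : u < n -> v \in neighbors u -> v < n.
Proof.
move=> lt_u; rewrite mem_cat mem_filter => /orP[|/andP[]//].
case: ifP => // u_gt0; rewrite mem_seq1 => /eqP->.
exact: ltn_trans (parent_lt _) lt_u.
Qed.

Lemma neighbors_uniq v : uniq (neighbors v).
Proof.
rewrite /neighbors cat_uniq; apply/and3P; split; first by case: ifP.
  apply/hasPn => w; rewrite mem_filter mem_children // => /and3P[_ w_gt0 /eqP par_w].
  have lt_vw : v < w by rewrite -par_w parent_lt.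
  case: ifP => // v_gt0; rewrite mem_seq1; apply/eqP => eq_w.
  by have := parent_lt v_gt0; rewrite -eq_w ltnNge ltnW.
apply: filter_uniq; rewrite /children.
have [y [j [i [yP ok_i j_gt0 ->]]]] := nested_pathP v.
rewrite nested_path_root //; case: ifP => // j_gt1; case: ifP => // ok_i1.
rewrite /= mem_seq1 andbT; apply/eqP; case: j j_gt1 {yP ok_i j_gt0 ok_i1} => // j.
by have := @block_size_gt0 j; rewrite /=; nia.
Qed.

Lemma val_ports ids (v : node (tree_network ids)) :
  [seq val u | u <- ports v] = neighbors v.
Proof.
rewrite /= pmap_filter; last exact: insubK.
by apply/all_filterP/allP => u /neighbors_lt-/(_ (ltn_ord v)); case: insubP => //= /negbTE->.
Qed.

Lemma size_neighbors v : size (neighbors v) <= 3.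
Proof.
rewrite /neighbors size_cat size_filter.
have : count (ltn^~ n) (children v) <= 2.
  apply: leq_trans (count_size _ _) _; rewrite /children.
  by case: (coord v) => j i; rewrite size_cat; do 2!case: ifP.
by case: ifP => _ /=; lia.
Qed.

Lemma tree_network_instance Delta c ids : 3 <= Delta -> 0 < c ->
    {in gtn n &, injective ids} -> (forall v, v < n -> 1 <= ids v <= n) ->
  tree_instance Delta c n (tree_network ids).
Proof.
move=> Delta_ge3 c_gt0 inj_ids ran_ids; split.
- exact: card_ord.
- by apply: parent_rel_tree => //; apply: parent_lt.
- move=> v; apply: leq_trans Delta_ge3.
  apply: leq_trans (size_neighbors v); rewrite -(@val_ports ids) size_map.
  apply: leq_trans (card_size _); apply: subset_leq_card; apply/subsetP => u.
  by rewrite inE -(mem_map val_inj) (@val_ports ids) mem_neighbors.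
- by move=> u v eq_id; apply: val_inj; apply: inj_ids; rewrite // inE ltn_ord.
- move=> v; have /andP[-> le_n] := ran_ids _ (ltn_ord v).
  by apply: leq_trans le_n _; rewrite -[X in X <= _]expn1 leq_pexp2l.
- move=> v; rewrite -(map_inj_uniq val_inj) val_ports; exact: neighbors_uniq.
- by move=> u v; rewrite -(mem_map val_inj) val_ports mem_neighbors.
Qed.

Lemma run_nat_run Out (A : algorithm Out) ids t (v : node (tree_network ids)) :
  run A t v = nat_run (A #|node (tree_network ids)|) neighbors ids t (val v).
Proof.
elim: t v => [|t IHt] v.
  by rewrite [LHS]/run [RHS]/= -[in RHS](@val_ports ids) size_map.
have -> : run A t.+1 v = if output (run A t v) is Some _ then run A t v
    else recv (run A t v) [seq send (run A t u) (index v (ports u)) | u <- ports v].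
  by [].
rewrite IHt [RHS]/=; case: output => //; congr (recv _ _).
rewrite -[in RHS](@val_ports ids v) -map_comp; apply: eq_map => u.
by rewrite /comp IHt -(@val_ports ids u) (index_map val_inj).
Qed.

Lemma block_coord_leq j i o : 0 < j -> o < block_size j -> 
  (block_coord j i o).1 <= j.
Proof.
elim: j i o => // j IHj i [|o] _ //= lt_o.
have bs_gt0 : 0 < block_size j by move: lt_o; rewrite ltnS; case: (block_size j); lia.
apply: leqW; apply: IHj; last by rewrite ltn_mod.
by case: j bs_gt0 {lt_o}.
Qed.

Lemma index_ok_leq j i i' : i' <= i -> index_ok j i -> index_ok j i'.
Proof.
rewrite /index_ok => le_i /orP[->//|lt_i].
by rewrite (leq_ltn_trans le_i lt_i) orbT.
Qed.

(** Types depend only on the offset inside a block. Since [u] and its translate are away from both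
    ends of the path and from the cut at [n], no neighbor is missing, and no edge spans more than
    one block. *)
Lemma neighbors_shift y j i q u : nested_path y j -> 0 < j -> 0 < i ->
    index_ok j (i + q).+1 -> y + (i + q).+2 * block_size j <= n ->
    y + i * block_size j <= u < y + i.+1 * block_size j ->
  neighbors (u + q * block_size j) = [seq w + q * block_size j | w <- neighbors u]
  /\ (forall w, w \in neighbors u -> u <= w + block_size j /\ w <= u + block_size j).
Proof.
move=> yP j_gt0 i_gt0 ok_i le_n /andP[le_u lt_u].
set d := q * block_size j.
have [jt [ix [ix' [cd_u cd_d le_jt ix0 ixok]]]] : exists jt ix ix',
    [/\ coord u = (jt, ix), coord (u + d) = (jt, ix'), jt <= j,
        (ix' == 0) = (ix == 0) & index_ok jt ix'.+1 = index_ok jt ix.+1].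
  have ok0 : index_ok j i by apply: index_ok_leq ok_i; lia.
  have ok1 : index_ok j (i + q) by apply: index_ok_leq ok_i.
  have lt_o : u - (y + i * block_size j) < block_size j by lia.
  have eq_u : u = y + i * block_size j + (u - (y + i * block_size j)) by lia.
  have cu := nested_path_coord yP ok0 lt_o.
  have cd := nested_path_coord yP ok1 lt_o.
  have eq_d : u + d = y + (i + q) * block_size j + (u - (y + i * block_size j)).
    by rewrite /d; lia.
  rewrite -eq_u in cu; rewrite -eq_d in cd.
  case: (u - _) lt_o cu cd {eq_u eq_d} => [|o] lt_o cu cd.
    have bc0 i' : block_coord j i' 0 = (j, i') by case: (j).
    exists j, i, (i + q); rewrite cu cd !bc0; split=> //; first by lia.
    by rewrite ok_i; apply/esym; apply: index_ok_leq ok_i; lia.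
  have le_j := block_coord_leq i j_gt0 lt_o.
  case def_c: (block_coord j i o.+1) => [jt ix] in le_j cu *.
  exists jt, ix, ix; split=> //; rewrite -def_c cd.
  by case: (j) j_gt0.
have le_bs := leq_block_size le_jt.
have bs_gt0 := block_size_gt0 j_gt0.
have le_bsu : block_size j <= u by nia.
have u_gt0 : 0 < u by lia.
have chE v w : v = u \/ v = u + d -> w \in children v -> w < n.
  move=> eq_v; rewrite /children.
  have -> : coord v = (jt, (coord v).2) by case: eq_v => ->; rewrite ?cd_u ?cd_d.
  have lt_n : v + block_size j < n by case: eq_v => ->; rewrite /d in le_n *; lia.
  by rewrite mem_cat => /orP[]; case: ifP => // _; rewrite mem_seq1 => /eqP->; lia.
have chF v : v = u \/ v = u + d -> [seq w <- children v | w < n] = children v.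
  by move=> eq_v; apply/all_filterP/allP => w; apply: chE.
split; last first.
  move=> w; rewrite /neighbors u_gt0 chF; last by left.
  rewrite /children /parent cd_u mem_cat mem_seq1 => /orP[/eqP->|].
    by case: ifP; lia.
  by rewrite mem_cat => /orP[]; case: ifP => // _; rewrite mem_seq1 => /eqP->; lia.
rewrite /neighbors u_gt0 addn_gt0 u_gt0 /= !chF; [|by left|by right].
rewrite /children /parent cd_u cd_d ix0 ixok; congr (_ :: _).
  by case: ifP; lia.
by rewrite map_cat; congr (_ ++ _); case: ifP => //= _; congr [:: _]; lia.
Qed.

Lemma nat_run_window Out (M : machine Out) ids ids' y j a q T :
    nested_path y j -> 0 < j -> T < a -> index_ok j (a + T + q).+1 ->
    y + (a + T + q).+2 * block_size j <= n ->
    (forall u, y + (a - T) * block_size j <= u < y + (a + T).+1 * block_size j ->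
       ids' (u + q * block_size j) = ids u) ->
  nat_run M neighbors ids' T (y + (a + q) * block_size j) =
  nat_run M neighbors ids T (y + a * block_size j).
Proof.
move=> yP j_gt0 lt_Ta ok_a le_n eq_ids; set b := block_size j in le_n eq_ids *.
have b_gt0 : 0 < b by apply: block_size_gt0.
(* The blocks within distance [T - t] of block [a]; as an edge moves by at most one block, they
   contain all neighbors of the nodes tracked one round later. *)
pose Z t u := t <= T /\ y + (a + t - T) * b <= u < y + (a + T - t).+1 * b.
have nbZ t u : Z t u -> neighbors (u + q * b) = [seq w + q * b | w <- neighbors u]
    /\ (forall w, w \in neighbors u -> u <= w + b /\ w <= u + b).
  case=> le_t /andP[le_u lt_u]; pose i := (u - y) %/ b.
  have /andP[le_i lt_i] : i * b <= u - y < i.+1 * b by rewrite leq_divM ltn_ceil.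
  have lt_ai : a + t - T < i.+1 by rewrite -(ltn_pmul2r b_gt0); lia.
  have lt_ia : i < (a + T - t).+1 by rewrite -(ltn_pmul2r b_gt0); lia.
  apply: (@neighbors_shift y j i q u yP j_gt0); rewrite -/b; try lia.
  - by apply: index_ok_leq ok_a; lia.
  - by apply: leq_trans le_n; rewrite leq_add2l leq_mul2r; lia.
  - by have := leq_trans (leq_addr _ _) le_u; lia.
have -> : y + (a + q) * b = y + a * b + q * b by lia.
apply: (@nat_run_shift _ _ _ _ Z).
- move=> t u Zu; split; first by have [] := nbZ _ _ Zu.
  apply: eq_ids; case: Zu => le_t /andP[le_u lt_u]; apply/andP; split.
    by apply: leq_trans le_u; rewrite leq_add2l leq_mul2r; lia.
  by apply: leq_trans lt_u _; rewrite leq_add2l leq_mul2r; lia.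
- move=> t u Zu; have [_ nbu] := nbZ _ _ Zu; case: Zu => lt_t /andP[le_u lt_u].
  have e1 : (a + t.+1 - T) * b = (a + t - T) * b + b.
    by rewrite -mulSnr; congr (_ * _); lia.
  have e2 : (a + T - t).+1 * b = (a + T - t.+1).+1 * b + b.
    by rewrite -mulSnr; congr (_ * _); lia.
  by split=> [|w /nbu[le_w le_w']]; split; lia.
- by split=> //; lia.
Qed.

Lemma card_set_ord_leq (A : {set 'I_n}) (s : seq nat) :
  (forall u, u \in A -> val u \in s) -> #|A| <= size s.
Proof.
move=> sub; rewrite cardE -(size_map val); apply: uniq_leq_size.
  by rewrite (map_inj_uniq val_inj) enum_uniq.
by move=> _ /mapP[u + ->]; rewrite mem_enum => /sub.
Qed.

Lemma leq_card_set_ord (A : {set 'I_n}) (s : seq nat) :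
  uniq s -> (forall w, w \in s -> exists2 u, u \in A & val u = w) ->
  size s <= #|A|.
Proof.
move=> uniq_s sub; rewrite cardE -(size_map val); apply: uniq_leq_size => // w.
by case/sub=> u uA <-; apply: map_f; rewrite mem_enum.
Qed.

(** * Levels in the nested paths *)

Local Notation rem i := (remaining (@parent_rel n parent) i).

(** When a node of type [i.+1] is examined, its subordinate root, of type [i], is gone; only its
    parent and the next root can remain. The cut at [n] only deletes neighbors, so this holds for
    all nodes. *)
Lemma remaining_type i v : v \in rem i -> i < (coord v).1.
Proof.
elim: i v => [|i IHi] v.
  have [y [j [i [yP ok_i j_gt0 ->]]]] := nested_pathP v.
  by rewrite nested_path_root.
rewrite /= in_setD inE negb_and => /andP[+ v_i]; rewrite v_i /=.
have := IHi v v_i; rewrite leq_eqVlt => /predU1P[eq_i|//]; apply: contraNT => _.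
have [y [j [ix [yP ok_ix j_gt0 def_v]]]] := nested_pathP v.
have cd_v : coord v = (j, ix) by rewrite def_v nested_path_root.
rewrite cd_v /= in eq_i; apply: (@card_set_ord_leq _ [:: parent v; v + block_size j]).
move=> u; rewrite inE -mem_neighbors => /andP[/IHi lt_i]; rewrite mem_cat => /orP[].
  by case: ifP => // _; rewrite !inE => ->.
rewrite mem_filter /children cd_v mem_cat => /andP[_ /orP[]]; case: ifP => // ok1.
  rewrite mem_seq1 => /eqP eq_u; move: lt_i; rewrite eq_u def_v.
  case: j yP ok_ix j_gt0 eq_i ok1 {def_v cd_v} => // j yP ok_ix _ eq_i j_gt0.
  have := nested_path_root (NestedSub yP ok_ix) (index_ok0 _) j_gt0.
  by rewrite mul0n addn0 => ->; rewrite /= eq_i ltnn.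
by rewrite mem_seq1 !inE => ->; rewrite orbT.
Qed.

(* A node is [t]-deep if, on each of the paths that lead to it, it is at distance
   at least [t] from the ends that erode while the levels are computed. *)
Definition deep_index (t j i : nat) : bool :=
  if j == k then (t <= i) && (i + t < n %/ block_size k) else i + t < L.

Inductive deep_path (t : nat) : nat -> nat -> Prop :=
| DeepTop : deep_path t 0 k
| DeepSub y j i : deep_path t y j.+1 -> deep_index t j.+1 i ->
    deep_path t (y + i * block_size j.+1).+1 j.

Definition deep (t j v : nat) : Prop :=
  exists y i, [/\ deep_path t y j, deep_index t j i & v = y + i * block_size j].

Lemma deep_index_ok t j i : deep_index t j i -> index_ok j i.
Proof.
rewrite /deep_index /index_ok; case: eqP => //= _; exact: leq_ltn_trans (leq_addr _ _).
Qed.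

Lemma deep_path_nested t y j : deep_path t y j -> nested_path y j.
Proof.
elim=> [|{}y {}j i _ yP /deep_index_ok ok_i]; [exact: NestedTop | exact: NestedSub].
Qed.

Lemma deep_index_leq s t j i : s <= t -> deep_index t j i -> deep_index s j i.
Proof. by rewrite /deep_index; case: ifP; lia. Qed.

Lemma deep_path_leq s t y j : s <= t -> deep_path t y j -> deep_path s y j.
Proof.
move=> le_st; elim=> [|{}y {}j i _ yP /(deep_index_leq le_st)]; first exact: DeepTop.
exact: DeepSub.
Qed.

Lemma deep_leq s t j v : s <= t -> deep t j v -> deep s j v.
Proof.
move=> le_st [y [i [yP ok_i ->]]]; exists y, i; split=> //.
  exact: deep_path_leq yP.
exact: deep_index_leq ok_i.
Qed.

Lemma deep_path_sub t y j : deep_path t y j -> j < k -> y + L * block_size j <= n.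
Proof.
have top i : i < n %/ block_size k -> i.+1 * block_size k <= n.
  by move=> lt_i; rewrite -leq_divRL // block_size_gt0.
elim=> [|{}y {}j i yP IHy ok_i _]; first by rewrite ltnn.
suff : y + i.+1 * block_size j.+1 <= n by rewrite mulSn /=; lia.
have [lt_jk|le_kj] := ltnP j.+1 k.
  apply: leq_trans (IHy lt_jk); rewrite leq_add2l leq_mul2r orbC.
  by move: ok_i; rewrite /deep_index ifN ?neq_ltn ?lt_jk //; lia.
have eq_j : j.+1 = k.
  by apply/eqP; rewrite eqn_leq le_kj (nested_path_leq (deep_path_nested yP)).
move: ok_i; rewrite /deep_index eq_j eqxx => ok_i.
case: (nested_path_first (deep_path_nested yP)) => [[-> _]|[]]; last by lia.
by rewrite add0n; apply: top; lia.
Qed.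

Lemma deep_block t y j i : deep_path t y j -> deep_index t j i ->
  y + i.+1 * block_size j <= n.
Proof.
move=> yP ok_i; have [lt_jk|le_kj] := ltnP j k.
  apply: leq_trans (deep_path_sub yP lt_jk); rewrite leq_add2l leq_mul2r orbC.
  by move: ok_i; rewrite /deep_index ifN ?neq_ltn ?lt_jk //; lia.
have eq_j : j = k.
  by apply/eqP; rewrite eqn_leq le_kj (nested_path_leq (deep_path_nested yP)).
case: (nested_path_first (deep_path_nested yP)) => [[-> _]|[]]; last by lia.
move: ok_i; rewrite /deep_index add0n eq_j eqxx => ok_i.
by rewrite -leq_divRL ?block_size_gt0 //; lia.
Qed.

Lemma deep_ltn t j v : 0 < j -> deep t j v -> v < n.
Proof.
move=> j_gt0 [y [i [yP ok_i ->]]]; apply: leq_trans (deep_block yP ok_i).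
by rewrite mulSn; have := block_size_gt0 j_gt0; lia.
Qed.

Lemma deep_type t j v : 0 < j -> deep t j v -> (coord v).1 = j.
Proof.
move=> j_gt0 [y [i [yP ok_i ->]]].
by rewrite (nested_path_root (deep_path_nested yP) (deep_index_ok ok_i)).
Qed.

(** The near end of a subordinate path does not erode, because its first root hangs from a deep node
    of higher type. Hence [deep_index] bounds [i] from below on the main path only. *)
Lemma deep_parent t j v : 0 < j -> deep t.+1 j v ->
  0 < v /\ exists2 j', j <= j' & deep t j' (parent v).
Proof.
move=> j_gt0 [y [i [yP ok_i ->]]].
rewrite (parentE (deep_path_nested yP) (deep_index_ok ok_i)) //.
have bs_gt0 := block_size_gt0 j_gt0.
case: i ok_i => [|i] ok_i /=; last first.
  split; first by rewrite mulSn; lia.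
  exists j => //; exists y, i; split=> //; first exact: deep_path_leq yP.
  by move: ok_i; rewrite /deep_index; case: ifP; lia.
case: yP j_gt0 bs_gt0 ok_i => [|{}y {}j i yP ok_i'] j_gt0 _ ok_i /=.
  by move: ok_i; rewrite /deep_index eqxx.
split; first by lia.
exists j.+1 => //; exists y, i; split=> //; first exact: deep_path_leq yP.
exact: deep_index_leq ok_i'.
Qed.

Lemma deep_next t j v : 0 < j -> deep t.+1 j v -> deep t j (v + block_size j).
Proof.
move=> j_gt0 [y [i [yP ok_i ->]]]; exists y, i.+1; split.
- exact: deep_path_leq yP.
- by move: ok_i; rewrite /deep_index; case: ifP; lia.
- by rewrite mulSn; lia.
Qed.

Lemma deep_child t j v : 1 < j -> t < L -> deep t j v -> deep t j.-1 v.+1.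
Proof.
case: j => // j j_gt0 lt_tL [y [i [yP ok_i ->]]].
exists (y + i * block_size j.+1).+1, 0; split; first exact: DeepSub.
  rewrite /deep_index ifN //; apply/eqP => /= eq_j.
  by have := nested_path_leq (deep_path_nested yP); rewrite eq_j ltnn.
by rewrite mul0n addn0.
Qed.

Lemma mem_neighbors_deep t j v w : 0 < j -> deep t.+1 j v ->
  w \in neighbors v -> [\/ w = parent v, 1 < j /\ w = v.+1 | w = v + block_size j].
Proof.
move=> j_gt0 dv; have [v_gt0 _] := deep_parent j_gt0 dv.
case: dv => y [i [yP ok_i def_v]].
have cd_v : coord v = (j, i).
  by rewrite def_v (nested_path_root (deep_path_nested yP) (deep_index_ok ok_i)).
rewrite /neighbors v_gt0 mem_cat mem_seq1 mem_filter /children cd_v.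
case/orP=> [/eqP->|/andP[_]]; first exact: Or31.
by rewrite mem_cat => /orP[]; case: ifP => // j1; rewrite mem_seq1 => /eqP;
  [move=> eq_w; apply: Or32 | apply: Or33].
Qed.

(** Parent, subordinate root and next root are [m]-deep of type above [m], so all three remain and
    the node keeps degree 3. *)
Lemma deep_remaining m t j (v : 'I_n) : k < L -> deep t j v -> m <= t -> m < j ->
  v \in rem m.
Proof.
move=> lt_kL; elim: m t j v => [|m IHm] t j v dv lt_mt lt_mj; first by rewrite inE.
have {lt_mt}dv : deep m.+1 j v := deep_leq lt_mt dv.
have j_gt0 : 0 < j by lia.
have le_jk : j <= k.
  by case: dv => y [i [yP _ _]]; apply: nested_path_leq (deep_path_nested yP).
rewrite /= in_setD (IHm m.+1 j v) // ?andbT; last by lia.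
rewrite inE (IHm m.+1 j v) //=; last by lia.
rewrite -ltnNge; have [v_gt0 [j' le_j' dp]] := deep_parent j_gt0 dv.
have dn := deep_next j_gt0 dv.
have dc : deep m j.-1 v.+1 by apply: (deep_child _ _ (deep_leq _ dv)); lia.
have bs_gt1 : 1 < block_size j.
  by case: (j) lt_mj => // -[|j1] // _; rewrite /=; nia.
apply: (@leq_card_set_ord _ [:: parent v; v.+1; v + block_size j]).
  by rewrite /= !inE !andbT; have := parent_lt v_gt0; lia.
have ch_v w : w \in children v -> w < n -> w \in neighbors v.
  by move=> w_v lt_w; rewrite mem_cat mem_filter lt_w w_v orbT.
have cd_v : coord v = (j, (coord v).2).
  by rewrite -[in RHS](deep_type j_gt0 dv); case: (coord v).
have nb : forall w, w \in [:: parent v; v.+1; v + block_size j] ->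
    w \in neighbors v /\ exists2 jw, m < jw & deep m jw w.
  move=> w; rewrite !inE => /or3P[]/eqP->.
  - by split; [rewrite /neighbors v_gt0 inE eqxx | exists j' => //; lia].
  - split; last by exists j.-1 => //; lia.
    apply: ch_v; last by apply: deep_ltn dc; lia.
    by rewrite /children cd_v mem_cat (_ : 1 < j) ?mem_seq1 ?eqxx //; lia.
  - split; last by exists j => //; lia.
    apply: ch_v; last exact: deep_ltn dn.
    case: (dv) => y [i [yP ok_i def_v]].
    have := nested_path_root (deep_path_nested yP) (deep_index_ok ok_i) j_gt0.
    have ok1 : index_ok j i.+1.
      by move: ok_i; rewrite /deep_index /index_ok; case: (j == k) => //=; lia.
    by rewrite -def_v /children => ->; rewrite mem_cat ok1 mem_seq1 eqxx orbT.
move=> w /nb[w_nb [jw lt_jw dw]]; have jw_gt0 : 0 < jw by lia.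
have lt_w := deep_ltn jw_gt0 dw.
exists (Ordinal lt_w) => //; rewrite inE (IHm m jw) //=.
by rewrite -mem_neighbors.
Qed.

Lemma deep_level j (v : 'I_n) : k < L -> 0 < j -> deep k j v ->
  level (@parent_rel n parent) k v = j.
Proof.
move=> lt_kL j_gt0 dv; have le_jk : j <= k.
  by case: dv => y [i [yP _ _]]; apply: nested_path_leq (deep_path_nested yP).
apply/eqP; rewrite eqn_leq leqNgt ltn_level //; apply/andP; split.
  by apply/negP => /remaining_type; rewrite (deep_type j_gt0 dv) ltnn.
rewrite -(prednK j_gt0) ltn_level; last by lia.
by apply: (deep_remaining lt_kL dv); lia.
Qed.

(** * Excluding E, then coloring windows of blocks *)

Section NoFastAlgorithm.

Variables (Delta c T : nat) (A : algorithm label).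
Hypotheses (Delta_ge3 : 3 <= Delta) (c_gt0 : 0 < c).
Hypothesis solA : solves_at (hierarchical_3half_coloring k) Delta c n A.
Hypothesis termA : forall G, tree_instance Delta c n G -> all_terminated A G T.
Hypothesis lt_L : 4 * T + k + 5 < L.

Definition valid_ids (ids : nat -> nat) : Prop :=
  {in gtn n &, injective ids} /\ (forall v, v < n -> 1 <= ids v <= n).

Definition out_label (ids : nat -> nat) (v : nat) : label :=
  odflt Exempt (output (nat_run (A #|'I_n|) neighbors ids T v)).

Lemma out_label_valid ids : valid_ids ids ->
  hierarchical_3half_coloring k (@parent_rel n parent)
    (fun v : 'I_n => out_label ids v).
Proof.
case=> inj_ids ran_ids.
have instG := tree_network_instance Delta_ge3 c_gt0 inj_ids ran_ids.
have [t [out [out_t Pout]]] := solA instG.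
suff -> : (fun v : 'I_n => out_label ids v) = out by [].
apply: funext => v; have := @termA _ instG v.
case out_T: (@output_at _ A (tree_network ids) T v) => [o|] // _.
have := output_at_leq (leq_maxl t T) (out_t v).
have := output_at_leq (leq_maxr t T) out_T => -> [<-].
by move: out_T; rewrite /output_at /out_label run_nat_run => ->.
Qed.

Definition flip (x : label) : label :=
  match x with White => Black | Black => White | _ => x end.

Definition is_WB (x : label) : bool :=
  match x with White | Black => true | _ => false end.

Lemma is_WB_flip x : is_WB (flip x) = is_WB x. Proof. by case: x. Qed.

Lemma is_WB_iter_flip d x : is_WB (iter d flip x) = is_WB x.
Proof. by elim: d => //= d <-; rewrite is_WB_flip. Qed.

Lemma lt_kL : k < L. Proof. by lia. Qed.

Section Rules.

Variable ids : nat -> nat.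
Hypothesis idsP : valid_ids ids.

Let valid := out_label_valid idsP.

(** The parent and the next root have level at least [j], so the subordinate root is the only
    possible witness for E. *)
Lemma exempt_deep j v : 0 < j -> j <= k -> deep k.+1 j v ->
    out_label ids v = Exempt ->
  1 < j /\ (is_WB (out_label ids v.+1) \/ out_label ids v.+1 = Exempt).
Proof.
move=> j_gt0 le_jk dv out_v; have lt_v := deep_ltn j_gt0 dv.
have lv_v : level (@parent_rel n parent) k (Ordinal lt_v) = j.
  exact: (@deep_level j (Ordinal lt_v) lt_kL j_gt0 (deep_leq (leqnSn k) dv)).
have [j1|j_gt1] := leqP j 1.
  by case: (level1_rule valid (v := Ordinal lt_v)) => //; rewrite lv_v; lia.
split=> //; have /(exempt_rule valid) :
    2 <= level (@parent_rel n parent) k (Ordinal lt_v) <= k.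
  by rewrite lv_v j_gt1.
case=> /(_ out_v)[u []] + + out_u _; rewrite -mem_neighbors lv_v.
case/(mem_neighbors_deep j_gt0 dv) => [eq_u|[_ eq_u] _|eq_u].
- have [_ [j' le_j' dp]] := deep_parent j_gt0 dv.
  by rewrite (@deep_level j' u lt_kL) ?eq_u //; lia.
- by move: out_u; rewrite eq_u => -[->|->|->]; [left|left|right].
- rewrite (@deep_level j) ?ltnn //; first exact: lt_kL.
  by rewrite eq_u; apply: deep_next.
Qed.

Lemma flip_step j y i : 0 < j -> j < k -> deep_path k.+1 y j -> i.+1 + k.+1 < L ->
    (forall v, deep k.+1 j v -> out_label ids v <> Exempt) ->
    is_WB (out_label ids (y + i * block_size j)) ->
  out_label ids (y + i.+1 * block_size j) = flip (out_label ids (y + i * block_size j)).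
Proof.
move=> j_gt0 lt_jk yP lt_i noE; set v := y + i * _; set w := y + i.+1 * _.
have def_w : w = v + block_size j by rewrite /w /v mulSn; lia.
have ok i' : i' + k.+1 < L -> deep_index k.+1 j i'.
  by rewrite /deep_index ifN // neq_ltn lt_jk.
have dv : deep k.+1 j v by exists y, i; split=> //; apply: ok; lia.
have dw : deep k.+1 j w by exists y, i.+1; split=> //; apply: ok.
have lt_v := deep_ltn j_gt0 dv; have lt_w := deep_ltn j_gt0 dw.
have lv u (lt_u : u < n) : deep k.+1 j u ->
    level (@parent_rel n parent) k (Ordinal lt_u) = j.
  move=> du; apply: (@deep_level j (Ordinal lt_u) lt_kL j_gt0 (deep_leq (leqnSn k) du)).
have e_vw : parent_rel parent (Ordinal lt_v) (Ordinal lt_w).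
  have w_gt0 : 0 < w by rewrite def_w; have := block_size_gt0 j_gt0; lia.
  rewrite /parent_rel /= w_gt0 (parentE (deep_path_nested yP)) ?eqxx //.
  by rewrite /index_ok; apply/orP; right; lia.
have low_w := low_level_labels valid (v := Ordinal lt_w).
have white_v := white_rule valid (v := Ordinal lt_v).
have black_v := black_rule valid (v := Ordinal lt_v).
rewrite (lv _ _ dw) in low_w; rewrite (lv _ _ dv) in white_v black_v.
have j_range : 1 <= j < k by rewrite j_gt0.
have [/= nR nG nY] := low_w j_range.
have {}white_v : out_label ids v = White ->
    out_label ids w <> White /\ out_label ids w <> Decline.
  by move=> out_v; apply: (white_v _ out_v (Ordinal lt_w)); rewrite ?j_gt0 ?lv.
have {}black_v : out_label ids v = Black ->
    out_label ids w <> Black /\ out_label ids w <> Decline.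
  by move=> out_v; apply: (black_v _ out_v (Ordinal lt_w)); rewrite ?j_gt0 ?lv.
have nE := noE _ dw.
case: (out_label ids v) white_v black_v => //= white_v black_v _.
  by have [] := white_v erefl; case: (out_label ids w) nR nG nY nE.
by have [] := black_v erefl; case: (out_label ids w) nR nG nY nE.
Qed.

Lemma flip_path j y i d : 0 < j -> j < k -> deep_path k.+1 y j -> i + d + k.+1 < L ->
    (forall v, deep k.+1 j v -> out_label ids v <> Exempt) ->
    is_WB (out_label ids (y + i * block_size j)) ->
  out_label ids (y + (i + d) * block_size j)
    = iter d flip (out_label ids (y + i * block_size j)).
Proof.
move=> j_gt0 lt_jk yP + noE wb; elim: d => [|d IHd] lt_d; first by rewrite addn0.
have {}IHd := IHd (ltac:(lia)); rewrite addnS flip_step ?IHd //; first by lia.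
by rewrite is_WB_iter_flip.
Qed.

End Rules.

Lemma nat_run_out_label ids ids' v v' :
  nat_run (A #|'I_n|) neighbors ids T v = nat_run (A #|'I_n|) neighbors ids' T v' ->
  out_label ids v = out_label ids' v'.
Proof. by rewrite /out_label => ->. Qed.

Lemma valid_ids_comp ids s : valid_ids ids -> {in gtn n &, injective s} ->
  (forall v, v < n -> s v < n) -> valid_ids (ids \o s).
Proof.
case=> inj_ids ran_ids inj_s lt_s; split=> [u v lt_u lt_v /= eq_uv|v lt_v].
  by apply: inj_s => //; apply: inj_ids eq_uv; rewrite inE; apply: lt_s.
exact: ran_ids (lt_s _ lt_v).
Qed.

(* If a path of type [j < k] is properly colored with W and B, moving the
   identifiers around one of its nodes by one step changes the parity of its
   distance to a remote node, whose view is unchanged. *)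
Lemma not_WB_deep j ids y : 0 < j -> j < k -> valid_ids ids ->
    (forall ids', valid_ids ids' ->
       forall v, deep k.+1 j v -> out_label ids' v <> Exempt) ->
  deep_path k.+1 y j -> ~~ is_WB (out_label ids y).
Proof.
move=> j_gt0 lt_jk idsP noE yP; apply/negP => wb0.
have b_gt0 := block_size_gt0 j_gt0; have le_n := deep_path_sub yP lt_jk.
set b := block_size j in b_gt0 le_n.
(* Rotates the identifiers of blocks 1 to [2 * T + 2] by one block. The view of block [T + 1]
   reappears at block [T + 2], while blocks [2 * T + 3] to [4 * T + 3], seen by block [3 * T + 3],
   keep theirs. *)
pose s u := if y + b <= u < y + 2 * b then u + (2 * T).+1 * b
  else if y + 2 * b <= u < y + (2 * T + 3) * b then u - b else u.
have end_lt : y + (2 * T + 3) * b <= n.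
  by apply: leq_trans le_n; rewrite leq_add2l leq_mul2r; lia.
have eqT : (2 * T + 3) * b = (2 * T).+1 * b + 2 * b by lia.
have sP : valid_ids (ids \o s).
  apply: valid_ids_comp => // [u v _ _|v lt_v]; rewrite /s.
    by do !case: ifP; lia.
  by do !case: ifP; lia.
have wba i d : i + d + k.+1 < L -> _ :=
  fun lt => flip_path idsP j_gt0 lt_jk yP lt (noE _ idsP).
have wb_a : is_WB (out_label ids (y + T.+1 * b)).
  have := wba 0 T.+1; rewrite mul0n addn0 => ->; rewrite ?is_WB_iter_flip //; lia.
have idx m : m < L -> index_ok j m by move=> lt_m; rewrite /index_ok lt_m orbT.
have blk m : m <= L -> y + m * b <= n.
  by move=> le_m; apply: leq_trans le_n; rewrite leq_add2l leq_mul2r le_m orbT.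
have eq_a : out_label (ids \o s) (y + (T.+1 + 1) * b) = out_label ids (y + T.+1 * b).
  apply: nat_run_out_label; apply: (nat_run_window _ (deep_path_nested yP)) => //.
  - by apply: idx; lia.
  - by apply: blk; lia.
  move=> u; rewrite mul1n -/b subSn // subnn mul1n => /andP[le_u lt_u] /=.
  have e1 : (T.+1 + T).+1 * b = (2 * T).+1 * b + b by lia.
  by rewrite /s; do !case: ifP; first [lia | by rewrite addnK].
have eq_b : out_label (ids \o s) (y + (3 * T + 3) * b)
    = out_label ids (y + (3 * T + 3) * b).
  rewrite -[in LHS](addn0 (3 * T + 3)).
  apply: nat_run_out_label; apply: (nat_run_window _ (deep_path_nested yP)) => //.
  - by lia.
  - by apply: idx; lia.
  - by apply: blk; lia.
  move=> u; rewrite mul0n addn0 -/b => /andP[le_u _] /=.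
  have e1 : (3 * T + 3 - T) * b = (2 * T + 3) * b by congr (_ * _); lia.
  by rewrite /s; do !case: ifP; lia.
have ids_b := wba T.+1 (2 * T).+2.
have ids'_b := flip_path (d := (2 * T).+1) sP j_gt0 lt_jk yP _ (noE _ sP) (i := T.+1 + 1).
rewrite eq_a (_ : T.+1 + 1 + _ = 3 * T + 3) ?eq_b in ids'_b; last by lia.
rewrite (_ : T.+1 + _ = 3 * T + 3) in ids_b; last by lia.
(* The remote block is at distance [2 * T + 2] before the rotation and [2 * T + 1] after it, so its
   label would be fixed by [flip]. *)
have := ids'_b; rewrite ids_b //=; try lia; move=> /(_ _ wb_a).
have := is_WB_iter_flip (2 * T).+1 (out_label ids (y + T.+1 * b)).
rewrite wb_a /= -/b; case: (flip _) => // _ eq_f; have := eq_f (ltac:(lia)); done.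
Qed.

(** The witness [v.+1] starts a deep path of type one less: it is not E by induction, and not W or B
    by [not_WB_deep], which needs the induction hypothesis for all identifiers. *)
Lemma not_exempt_deep j : 0 < j -> j <= k -> forall ids, valid_ids ids ->
  forall v, deep k.+1 j v -> out_label ids v <> Exempt.
Proof.
elim: j => // j IHj _ lt_jk ids idsP v dv out_v.
have [//|] := exempt_deep idsP _ lt_jk dv out_v; rewrite ltnS => j_gt0.
have noE := IHj j_gt0 (ltnW lt_jk).
have dc : deep k.+1 j v.+1 by apply: (deep_child _ _ dv); lia.
case=> [|/(noE _ idsP _ dc)//]; apply/negP.
case: dv => y [i [yP ok_i ->]].
exact: (not_WB_deep j_gt0 lt_jk idsP noE (DeepSub yP ok_i)).
Qed.

Local Notation b := (block_size k).
Local Notation N := (n %/ block_size k).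

(** The block at position [i] receives the chunk of identifiers numbered [nth 0 p i], in order;
    nodes after the last complete block keep their own. *)
Definition block_ids (p : seq nat) (v : nat) : nat :=
  (if v < N * b then nth 0 p (v %/ b) * b + v %% b else v).+1.

Lemma block_ids_valid p : perm_eq p (iota 0 N) -> valid_ids (block_ids p).
Proof.
move=> perm_p; have b_gt0 := block_size_gt0 k_gt0.
have size_p : size p = N by rewrite (perm_size perm_p) size_iota.
have uniq_p : uniq p by rewrite (perm_uniq perm_p) iota_uniq.
have lt_p i : i < N -> nth 0 p i < N.
  move=> lt_i; have := mem_nth 0 (_ : i < size p).
  by rewrite size_p lt_i (perm_mem perm_p) mem_iota => /(_ isT).
have lt_b v : v < N * b -> nth 0 p (v %/ b) * b + v %% b < N * b.
  move=> lt_v; have := lt_p (v %/ b); rewrite ltn_divLR // => /(_ lt_v).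
  have : v %% b < b by rewrite ltn_mod.
  by move: (nth _ _ _) (v %% b) => x r; nia.
have le_n : N * b <= n by apply: leq_divM.
split=> [u v _ _|v lt_v]; rewrite /block_ids; last first.
  by case: ifP => [/lt_b|]; lia.
case: ifP => [lt_u|ge_u]; case: ifP => [lt_v|ge_v] [] eq_uv; last by [].
- have eq_d : u %/ b = v %/ b.
    have modE x : x %% b %/ b = 0 by rewrite divn_small ?ltn_mod.
    have := congr1 (divn^~ b) eq_uv; rewrite /= !divnMDl // !modE. rewrite !addn0.
    by move/eqP; rewrite nth_uniq ?size_p ?ltn_divLR // => /eqP.
  by rewrite (divn_eq u b) (divn_eq v b); move: eq_uv; rewrite eq_d; lia.
- by have := lt_b u lt_u; lia.
- by have := lt_b v lt_v; lia.
Qed.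

Lemma block_idsE p i o : i < N -> o < b ->
  block_ids p (i * b + o) = (nth 0 p i * b + o).+1.
Proof.
move=> lt_i lt_o; rewrite /block_ids divnMDl ?(leq_ltn_trans _ lt_o) //.
rewrite (divn_small lt_o) addn0.
by rewrite modnMDl (modn_small lt_o) ifT //; nia.
Qed.

(* A permutation of the blocks that places [w] at the blocks from [k + 2] on. *)
Definition place (w : seq nat) : seq nat :=
  let r := [seq x <- iota 0 N | x \notin w] in take k.+2 r ++ w ++ drop k.+2 r.

Lemma place_perm w : uniq w -> all (gtn N) w -> perm_eq (place w) (iota 0 N).
Proof.
move=> uniq_w /allP lt_w; set r := [seq x <- iota 0 N | x \notin w].
have -> : perm_eq (place w) (iota 0 N) = perm_eq (w ++ r) (iota 0 N).
  by rewrite /place -/r perm_catCA cat_take_drop.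
apply: uniq_perm; rewrite ?iota_uniq //.
  rewrite cat_uniq uniq_w filter_uniq ?iota_uniq // andbT.
  by apply/hasPn => x; rewrite mem_filter => /andP[].
move=> x; rewrite mem_cat mem_filter mem_iota add0n leq0n /=.
by case x_w: (x \in w) => //=; apply/esym; apply: lt_w.
Qed.

Lemma nth_place w d : uniq w -> all (gtn N) w -> size w + k.+2 <= N ->
  d < size w -> nth 0 (place w) (k.+2 + d) = nth 0 w d.
Proof.
move=> uniq_w lt_w le_N lt_d; have := perm_size (place_perm uniq_w lt_w).
rewrite size_iota /place; set r := [seq x <- _ | _].
rewrite !size_cat size_take size_drop => size_p.
have size_r : size (take k.+2 r) = k.+2.
  by apply: size_takel; move: size_p; case: ifP; lia.
by rewrite !nth_cat size_r ltnNge leq_addr /= addKn lt_d.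
Qed.

(** Block [k.+2 + T] is the middle of a window of length [2 * T + 1] put in place by [place]. Where
    the color is used, the last case stands for Yellow alone. *)
Definition window_color (w : seq nat) : 'I_3 :=
  match out_label (block_ids (place w)) ((k.+2 + T) * b) with
  | Red => inord 0 | Green => inord 1 | _ => inord 2 end.

Hypothesis le_N : 2 * T + 2 * k + 10 <= N.

(** Both windows occur in the single assignment [block_ids (place w)], seen by two adjacent roots of
    level [k], which must get different colors. *)
Lemma window_color_neq w : size w = (2 * T).+2 -> uniq w -> all (gtn N) w ->
  window_color (take (2 * T).+1 w) != window_color (behead w).
Proof.
move=> size_w uniq_w lt_w.
have b_gt0 := block_size_gt0 k_gt0.
have le_n : N * b <= n by apply: leq_divM.
set m := k.+2 + T; set ids := block_ids (place w).
have idsP : valid_ids ids by apply/block_ids_valid/place_perm.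
have kk : index_ok k =1 xpredT by move=> i; rewrite /index_ok eqxx.
have window s q : q <= 1 -> size s = (2 * T).+1 -> uniq s -> all (gtn N) s ->
    (forall d, d < size s -> nth 0 s d = nth 0 w (d + q)) ->
  out_label (block_ids (place s)) (m * b) = out_label ids ((m + q) * b).
  move=> le_q size_s uniq_s lt_s nth_s; apply: nat_run_out_label; apply/esym.
  have := nat_run_window (A #|'I_n|) NestedTop k_gt0 (_ : T < m) (a := m) (T := T) (q := q).
  rewrite !add0n; apply; rewrite ?kk //; first by rewrite /m; lia.
    by apply: leq_trans le_n; rewrite leq_mul2r /m; lia.
  move=> u /andP[le_u lt_u]; have lt_i : u %/ b < (m + T).+1 by rewrite ltn_divLR.
  have le_i : m - T <= u %/ b by rewrite leq_divRL.
  rewrite (divn_eq u b) addnAC -mulnDl /ids !block_idsE ?ltn_mod //;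
    try by rewrite /m in lt_i; lia.
  have [d lt_d ->] : exists2 d, d < size s & u %/ b = k.+2 + d.
    by exists (u %/ b - k.+2); rewrite /m in le_i lt_i; lia.
  have sz_s : size s + k.+2 <= N by rewrite size_s; lia.
  have sz_w : size w + k.+2 <= N by rewrite size_w; lia.
  have lt_w' : d + q < size w by rewrite size_w; lia.
  by rewrite -[k.+2 + d + q]addnA (nth_place uniq_w) // (nth_place uniq_s) // nth_s.
have deepm i : i <= 1 -> deep k.+1 k ((m + i) * b).
  move=> le_i; exists 0, (m + i); split=> //; first exact: DeepTop.
  by rewrite /deep_index eqxx /m; lia.
have out_k i (le_i : i <= 1) (lt_v : (m + i) * b < n) :
    level (@parent_rel n parent) k (Ordinal lt_v) = k /\
    [\/ out_label ids ((m + i) * b) = Red, out_label ids ((m + i) * b) = Green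
      | out_label ids ((m + i) * b) = Yellow].
  have lv : level (@parent_rel n parent) k (Ordinal lt_v) = k.
    exact: (@deep_level k (Ordinal lt_v) lt_kL k_gt0 (deep_leq (leqnSn k) (deepm i le_i))).
  split=> //; have [/=] := level_k_labels (out_label_valid idsP) lv.
  have := not_exempt_deep k_gt0 (leqnn k) idsP (deepm i le_i).
  by case: (out_label _ _) => // *; [apply: Or31 | apply: Or32 | apply: Or33].
have lt0 := deep_ltn k_gt0 (deepm 0 isT); have lt1 := deep_ltn k_gt0 (deepm 1 isT).
have [lv0 out0] := out_k 0 isT lt0; have [lv1 out1] := out_k 1 isT lt1.
have e01 : parent_rel parent (Ordinal lt0) (Ordinal lt1).
  rewrite /parent_rel /= muln_gt0 addn1 b_gt0 /=.
  have := parentE NestedTop (_ : index_ok k m.+1) k_gt0.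
  by rewrite kk !add0n addn0 => -> //; rewrite eqxx.
have := level_k_rule (out_label_valid idsP) e01 lv0 lv1 out0; rewrite /= => ne01.
have nth_take' d : d < (2 * T).+1 -> nth 0 (take (2 * T).+1 w) d = nth 0 w (d + 0).
  by move=> lt_d; rewrite nth_take // addn0.
have -> : window_color (take (2 * T).+1 w) = match out_label ids ((m + 0) * b) with
  | Red => inord 0 | Green => inord 1 | _ => inord 2 end.
  have size_t : size (take (2 * T).+1 w) = (2 * T).+1 by rewrite size_takel // size_w.
  rewrite /window_color -/m (window _ 0) ?take_uniq ?size_t //.
  by apply/allP => x /mem_take; apply: (allP lt_w).
have -> : window_color (behead w) = match out_label ids ((m + 1) * b) with
  | Red => inord 0 | Green => inord 1 | _ => inord 2 end.
  have size_t : size (behead w) = (2 * T).+1 by rewrite size_behead size_w.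
  rewrite /window_color -/m (window _ 1) ?size_t //.
  - by case: (w) uniq_w => //= x s /andP[].
  - by apply/allP => x /mem_behead; apply: (allP lt_w).
  - by move=> d _; rewrite nth_behead addn1.
by case: out0 out1 ne01 => -> [] -> // _; apply/eqP => /(congr1 val); rewrite /= !inordK.
Qed.

Lemma block_count_leq : N <= tower (2 * T) 3.
Proof.
rewrite -[3]card_ord; apply: (@linial _ window_color) => w size_w sorted_w lt_w.
apply/eqP; apply: window_color_neq => //.
exact: sorted_uniq ltn_trans ltnn w sorted_w.
Qed.

End NoFastAlgorithm.

End NestedPaths.

(** With [k = L = 1] the nested paths are a plain path. *)
Lemma tree_instance_exists Delta c n : 3 <= Delta -> 0 < c -> 0 < n ->
  exists G, tree_instance Delta c n G.
Proof.
move=> Delta_ge3 c_gt0 n_gt0; exists (tree_network 1 1 n succn).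
by apply: tree_network_instance => // u v _ _ [].
Qed.

(** * Tower estimates and conclusion *)

Lemma block_size_leq L j : block_size L j <= L.+1 ^ j.
Proof.
elim: j => //= j IHj; rewrite expnS mulSn.
have : 0 < L.+1 ^ j by rewrite expn_gt0.
by move: (_ ^ j) IHj => x; nia.
Qed.

Lemma towerD i j m : tower (i + j) m = tower i (tower j m).
Proof. exact: iterD. Qed.

Lemma leq_tower i m m' : m <= m' -> tower i m <= tower i m'.
Proof. by move=> le_m; elim: i => //= i IHi; rewrite leq_exp2l. Qed.

Lemma tower_gt i : i < tower i 1.
Proof. by elim: i => //= i IHi; apply: leq_ltn_trans IHi (ltn_expl _ _). Qed.

Lemma leq_tower_l i j m : i <= j -> tower i m <= tower j m.
Proof.
move=> /subnKC <-; elim: (j - i) => [|d IHd]; first by rewrite addn0.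
by rewrite addnS; apply: leq_trans IHd (ltnW (ltn_expl _ _)).
Qed.

(** The single number [m] dominates [N] in both cases, and [2 * m] dominates the base of the block
    size bound. Then [n <= 2 ^ (m * m)], which three exponentials above [m] cover: hence 23 = 20 +
    3. *)
Lemma leq_block_tower k T n :
    let N := n %/ block_size (4 * T + k + 6) k in
    0 < k -> (2 * T + 2 * k + 10 <= N -> N <= tower (2 * T) 3) ->
  n <= tower (2 * T + 2 * k + 23) 1.
Proof.
move=> N k_gt0 le_N; pose m := tower (2 * T + 2 * k + 20) 1.
have lt_m : 2 * T + 2 * k + 20 < m := tower_gt _.
have N_le : N <= m.
  have [/le_N le_N'|] := leqP (2 * T + 2 * k + 10) N; last by lia.
  apply: leq_trans le_N' _; apply: (@leq_trans (tower (2 * T + 2) 1)).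
    by rewrite towerD leq_tower.
  by apply: leq_tower_l; lia.
have lt_2m x : x < 2 ^ x by apply: ltn_expl.
have le_2m : 2 * m <= 2 ^ m.
  rewrite -[X in 2 * X](ltn_predK lt_m) -[X in 2 ^ X](ltn_predK lt_m) expnS.
  by rewrite leq_mul2l lt_2m.
have bs_le : block_size (4 * T + k + 6) k <= 2 ^ (m * k).
  apply: leq_trans (block_size_leq _ _) _; rewrite expnM leq_exp2r //.
  apply: (@leq_trans (2 * m)); first by lia.
  exact: le_2m.
have bs_gt0 := block_size_gt0 (4 * T + k + 6) k_gt0.
have n_le : n <= 2 ^ (m * m).
  apply: (@leq_trans (2 ^ m * 2 ^ (m * k))).
    apply: ltnW; apply: leq_trans (ltn_ceil n bs_gt0) _.
    by apply: leq_mul => //; apply: leq_ltn_trans (lt_2m m).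
  by rewrite -expnD leq_exp2l // -mulnS leq_mul2l; lia.
apply: (leq_trans n_le).
rewrite (_ : 2 * T + 2 * k + 23 = 3 + (2 * T + 2 * k + 20)); last by lia.
rewrite towerD -/m /tower /= !leq_exp2l //.
apply: (@leq_trans (2 ^ m * 2 ^ m)); first by apply: leq_mul; apply: ltnW.
rewrite -expnD leq_exp2l // addnn -mul2n.
exact: le_2m.
Qed.

Lemma coloring_lower_bound k Delta c A T' n : 0 < k -> 3 <= Delta -> 0 < c ->
    solves (hierarchical_3half_coloring k) Delta c A ->
    alg_complexity Delta c A T' -> 0 < n ->
  n <= tower (2 * T' n + 2 * k + 23) 1.
Proof.
move=> k_gt0 Delta_ge3 c_gt0 solA worstA n_gt0.
have [maxA _] := worstA n n_gt0.
have termA G : tree_instance Delta c n G -> all_terminated A G (T' n).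
  move=> /maxA[t [term_t _] le_t] v.
  case out_v: (output_at A t v) (@term_t v) => [o|] // _.
  by rewrite (output_at_leq le_t out_v).
apply: leq_block_tower => //.
apply: (@block_count_leq _ _ _ _ _ n_gt0 Delta c _ A) => //; try lia.
by move=> G; apply: solA.
Qed.

Theorem corollary10 (k Delta c : nat)
    (hk : 1 <= k) (hDelta : 3 <= Delta) (hc : 1 <= c) :
  exists T : nat -> nat,
    problem_complexity (hierarchical_3half_coloring k) Delta c T /\
    bigTheta T logstar.
Proof.
have solves_coloring :
    solves (hierarchical_3half_coloring k) Delta c (coloring_algorithm k c).
  move=> n G instG; have [out outP] := coloring_output hk instG.
  by exists (coloring_time k c n), out.
have terminates n G : tree_instance Delta c n G ->
    all_terminated (coloring_algorithm k c) G (coloring_time k c n).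
  by move=> instG v; have [out [-> _]] := coloring_output hk instG.
have [T optT T_le] := problem_complexity_exists
  (fun n => tree_instance_exists hDelta hc) solves_coloring terminates.
exists T; split=> //.
(* The threshold forces [T n >= 1], since otherwise [n <= tower (2 * k + 23) 1], and
   [logstar n >= 1]. Additive constants then become factors: [2 * T n + 2 * k + 23 <= (2 * k + 25) *
   T n], and likewise for the running time. *)
exists (2 * k + 25), (k + palette c + 1), (tower (2 * k + 23) 1 + 2).
split=> [||n n_ge]; [by lia | by lia |].
have n_gt0 : 0 < n by lia.
case: optT => -[A solA worstA] _.
have n_le := coloring_lower_bound hk hDelta hc solA worstA n_gt0.
split; last first.
  apply: leq_trans (T_le n n_gt0) _; rewrite /coloring_time.
  by have := @logstar_gt0 n (ltac:(lia)); nia.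
have T_gt0 : 0 < T n.
  by rewrite lt0n; apply/eqP => T0; move: n_le; rewrite T0 muln0 add0n; lia.
by apply: leq_trans (leq_tower_logstar n_le) _; nia.
Qed.
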